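(* Let $M$ be a matroid of rank $r$ on the ground set $E$ with $|E|=n+1$, let $e\in E$, and let $I=I_{\mathcal{S}(M,e)}$ be the associated matroid Steiner ideal in the polynomial ring over a field $\mathbf{k}$ in the $n$ variables $x_i$, $i\in E-\{e\}$. Then for every $i\ge 0$, $$\beta_i(I)=\Bigl|\sum_{\substack{X,Y\in L(M^\star)\\ r(X)=n-r-i,\ e\nleq Y}}\mu_{L(M^\star)}(X,Y)\Bigr|,$$ where $r(X)$ denotes the rank of $X$ in $L(M^\star)$.
   Context: $L(M^\star)$ is the lattice of flats of the dual matroid $M^\star$ (of rank $|E|-r$), $\mu_{L(M^\star)}$ is its Möbius function (with $\mu(X,Y)=0$ unless $X\le Y$), and $e\nleq Y$ means that the flat $Y$ does not contain $e$. The port of $M$ at $e$ is $\mathcal{P}=\{C-\{e\}: C\text{ a circuit of }M,\ e\in C\}$, and the matroid Steiner complex is $\mathcal{S}(M,e)=\{F\subseteq E-\{e\}: P\nsubseteq F\text{ for all }P\in\mathcal{P}\}$. The face ideal $I_\Delta$ of a simplicial complex $\Delta$ is the ideal generated by all squarefree monomials whose support is not in $\Delta$; $I_{\mathcal{S}(M,e)}$ is called a matroid Steiner ideal. $\beta_i(I)$ is the rank of the $i$-th free module $F_i$ in a minimal free resolution $\cdots\to F_1\to F_0\to I\to 0$ of $I$ as a module over the polynomial ring; in particular $\beta_0(I)$ is the minimal number of generators of $I$. *)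

(* Defs.v *)
From Stdlib Require Import ClassicalEpsilon.
From mathcomp Require Import all_boot all_order all_algebra.
From mathcomp Require Import mpoly.

Set Implicit Arguments.
Unset Strict Implicit.
Unset Printing Implicit Defensive.

Import Order.TTheory GRing.Theory Num.Theory.

Local Open Scope ring_scope.

Record matroid (T : finType) := Matroid {
  indep : {set {set T}};
  indep0 : set0 \in indep;
  indepS : forall A B : {set T}, A \subset B -> B \in indep -> A \in indep;
  indep_aug : forall A B : {set T}, A \in indep -> B \in indep ->
    (#|A| < #|B|)%N -> exists2 x, x \in B :\: A & x |: A \in indep
}.

Section MatroidNotions.
Variables (T : finType) (M : matroid T).

Definition bases : {set {set T}} :=
  [set B | maxset [pred A | A \in indep M] B].

Definition circuits : {set {set T}} :=
  [set C | minset [pred A | A \notin indep M] C].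

Definition rk (A : {set T}) : nat :=
  \max_(B in indep M | B \subset A) #|B|.

Definition flats : {set {set T}} :=
  [set X : {set T} | [forall x, (x \notin X) ==> (rk X < rk (x |: X))%N]].

Definition dual_indep : {set {set T}} :=
  [set A : {set T} | [exists B in bases, A \subset ~: B]].

Lemma basis_indep B : B \in bases -> B \in indep M.
Proof. by rewrite inE => /maxsetp. Qed.

Lemma leq_card_basis A B : A \in indep M -> B \in bases -> (#|A| <= #|B|)%N.
Proof.
move=> iA bB; rewrite leqNgt; apply/negP => ltBA.
have [x /setDP[_ xB] ixB] := indep_aug (basis_indep bB) iA ltBA.
move: bB; rewrite inE => /maxsetP[_ /(_ _ ixB (subsetUr _ _)) eqB].
by rewrite -eqB setU11 in xB.
Qed.

Lemma indep_extend A B : A \in indep M -> B \in bases ->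
  exists2 C, C \in bases & A \subset C /\ C \subset A :|: B.
Proof.
move=> iA bB.
pose P := [pred C : {set T} | (C \in indep M) && (C \subset A :|: B)].
have PA : P A by rewrite /= iA subsetUl.
have [C /maxsetP[/andP[iC sC] maxC] sAC] := maxset_exists PA.
exists C => //; have leBC : (#|B| <= #|C|)%N.
  rewrite leqNgt; apply/negP => ltCB.
  have [x /setDP[xB xC] ixC] := indep_aug iC (basis_indep bB) ltCB.
  have PxC : P (x |: C) by rewrite /= ixC subUset sub1set inE xB orbT.
  by move: xC; rewrite -(maxC _ PxC (subsetUr _ _)) setU11.
rewrite inE; apply/maxsetP; split => //= D iD sCD.
apply/esym/eqP; rewrite eqEcard sCD /=.
exact: leq_trans (leq_card_basis iD bB) leBC.
Qed.

Lemma dual_indep0 : set0 \in dual_indep.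
Proof.
have [B maxB _] := @maxset_exists _ [pred A | A \in indep M] _ (indep0 M).
by rewrite inE; apply/existsP; exists B; rewrite inE maxB sub0set.
Qed.

Lemma dual_indepS (A B : {set T}) :
  A \subset B -> B \in dual_indep -> A \in dual_indep.
Proof.
rewrite !inE => sAB /exists_inP[C bC sBC]; apply/exists_inP.
by exists C => //; apply: subset_trans sBC.
Qed.

Lemma dual_indep_aug (A B : {set T}) :
  A \in dual_indep -> B \in dual_indep -> (#|A| < #|B|)%N ->
  exists2 x, x \in B :\: A & x |: A \in dual_indep.
Proof.
rewrite !inE => /exists_inP[A0 bA0 sA] /exists_inP[B0 bB0 sB] ltAB.
have iB0A : B0 :\: A \in indep M.
  by apply: indepS (basis_indep bB0); apply: subsetDl.
have [C bC [sBC sC]] := indep_extend iB0A bA0.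
have dAC : A \subset ~: C.
  apply/subsetP => x xA; rewrite inE; apply/negP => /(subsetP sC).
  by rewrite !inE xA /= => xA0; have := subsetP sA _ xA; rewrite inE xA0.
case: (boolP (B :\: A \subset C)) => [sBAC|/subsetPn[x xBA xC]]; last first.
  exists x => //; rewrite inE; apply/exists_inP; exists C => //.
  by rewrite subUset sub1set inE xC.
have disjB x : x \in B0 -> x \notin B.
  by move=> xB0; apply/negP => /(subsetP sB); rewrite inE xB0.
have dis : (B :\: A) :&: (B0 :\: A) = set0.
  apply/setP => x; rewrite !inE.
  by case xB0: (x \in B0); rewrite ?(negPf (disjB _ xB0)) ?andbF.
have leC : (#|B :\: A| + #|B0 :\: A| <= #|C|)%N.
  rewrite -cardsUI dis cards0 addn0; apply: subset_leq_card.
  by rewrite subUset sBAC.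
have leI : (#|B0 :&: A| <= #|A :\: B|)%N.
  apply/subset_leq_card/subsetP => x; rewrite !inE => /andP[xB0 ->].
  by rewrite disjB.
have ltD : (#|A :\: B| < #|B :\: A|)%N.
  by rewrite -(ltn_add2l #|A :&: B|) cardsID setIC cardsID.
have := leq_card_basis (basis_indep bC) bB0.
rewrite -(cardsID A B0) leqNgt => /negP[]; apply: leq_trans leC.
by rewrite ltn_add2r; apply: leq_ltn_trans ltD.
Qed.

(* The bases of the dual are the complements of the bases of M. *)
Definition dual : matroid T := Matroid dual_indep0 dual_indepS dual_indep_aug.

Definition port (e : T) : {set {set T}} :=
  [set C :\ e | C in circuits & e \in C].

Definition steiner_complex (e : T) : {set {set T}} :=
  [set F in powerset [set~ e] | [forall P in port e, ~~ (P \subset F)]].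

End MatroidNotions.

(* The poset is L ordered by inclusion; the recursion is on a bound for #|Y|.
   See mobiusE for the usual equation. *)
Fixpoint mobius_rec (T : finType) (L : {set {set T}}) (m : nat)
    (X Y : {set T}) : int :=
  if m is m'.+1 then
    if X == Y then 1
    else if X \subset Y then
      - \sum_(Z in L | (X \subset Z) && (Z \proper Y)) mobius_rec L m' X Z
    else 0
  else 0.

Definition mobius (T : finType) (L : {set {set T}}) (X Y : {set T}) : int :=
  mobius_rec L #|Y|.+1 X Y.

Lemma mobiusE (T : finType) (L : {set {set T}}) (X Y : {set T}) :
  mobius L X Y =
    if X == Y then 1
    else if X \subset Y then
      - \sum_(Z in L | (X \subset Z) && (Z \proper Y)) mobius L X Z
    else 0.
Proof.
have stable m (Z : {set T}) : (#|Z| < m)%N -> mobius_rec L m X Z = mobius L X Z.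
  rewrite /mobius; move: {2}#|Z|.+1 (ltnSn #|Z|) => p.
  elim: p m Z => [//|p IH] [//|m] Z ltZp ltZm /=.
  case: ifP => // _; case: ifP => // _; congr (- _).
  apply: eq_bigr => W /and3P[_ _ /proper_card ltWZ].
  have ltWp : (#|W| < p)%N by apply: leq_trans ltWZ _.
  rewrite IH //; last exact: leq_trans ltWZ _.
  by rewrite -(IH #|Z|).
rewrite {1}/mobius /=; case: ifP => // _; case: ifP => // _; congr (- _).
by apply: eq_bigr => Z /and3P[_ _ /proper_card ltZY]; rewrite stable.
Qed.

(* For V : {set T}, the polynomial ring in the variables x_a (a in V) is
   {mpoly k[#|V|]}, the variable 'X_j standing for x_a with a = enum_val j. *)
Definition sqfree_monomial (k : fieldType) (T : finType) (V F : {set T}) :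
    {mpoly k[#|V|]} :=
  \prod_(j < #|V| | enum_val j \in F) 'X_j.

(* D is a simplicial complex on the vertex set V. *)
Definition face_ideal (k : fieldType) (T : finType) (V : {set T})
    (D : {set {set T}}) (f : {mpoly k[#|V|]}) : Prop :=
  exists c : {set T} -> {mpoly k[#|V|]},
    f = \sum_(F in powerset V | F \notin D) c F * sqfree_monomial k V F.

Definition steiner_ideal (k : fieldType) (T : finType) (M : matroid T) (e : T) :
    {mpoly k[#|[set~ e]|]} -> Prop :=
  @face_ideal k T [set~ e] (steiner_complex M e).

Arguments face_ideal k {T} V D f.
Arguments steiner_ideal k {T} M e f.

(* F_i is the free module 'rV[R]_(frank i); matrices act on row vectors from
   the right, fdiff i : F_{i+1} -> F_i and faug : F_0 -> R. *)
Record free_complex (R : comNzRingType) := FreeComplex {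
  frank : nat -> nat;
  fdiff : forall i, 'M[R]_(frank i.+1, frank i);
  faug : 'cV[R]_(frank 0)
}.

(* Exactness of ... -> F_1 -> F_0 -> I -> 0 for an ideal I of R. *)
Definition free_resolution (R : comNzRingType) (I : R -> Prop)
    (F : free_complex R) : Prop :=
  [/\ forall f : R,
        I f <-> exists v : 'rV_(frank F 0), (v *m faug F) ord0 ord0 = f,
      forall v : 'rV_(frank F 0),
        v *m faug F = 0 <-> exists w, w *m fdiff F 0 = v &
      forall i (v : 'rV_(frank F i.+1)),
        v *m fdiff F i = 0 <-> exists w, w *m fdiff F i.+1 = v].

(* Minimality: d(F_{i+1}) is contained in m F_i, where m = (x_1, ..., x_n) is
   the ideal of the polynomials with zero constant term. *)
Definition minimal_free_resolution (k : fieldType) (n : nat)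
    (I : {mpoly k[n]} -> Prop) (F : free_complex {mpoly k[n]}) : Prop :=
  free_resolution I F /\ forall i p q, (fdiff F i p q)@_0%MM = 0.

Lemma free_complex_inhabited (R : comNzRingType) : inhabited (free_complex R).
Proof. by split; exists (fun=> 0%N) => [i|]; apply: 0. Qed.

(* The ranks do not depend on the minimal free resolution that is chosen. *)
Definition betti (k : fieldType) (n : nat) (I : {mpoly k[n]} -> Prop)
    (i : nat) : nat :=
  frank (epsilon (free_complex_inhabited {mpoly k[n]})
                 (minimal_free_resolution I)) i.

(* Main.v *)
Require Import Defs.
From Stdlib Require Import ClassicalEpsilon.
From mathcomp Require Import all_boot all_order all_algebra.
From mathcomp Require Import mpoly.
From mathcomp Require Import zify ring.

Set Implicit Arguments.
Unset Strict Implicit.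
Unset Printing Implicit Defensive.

Import Order.TTheory GRing.Theory Num.Theory.

Local Open Scope ring_scope.

(** Let N be the dual matroid of M and V = E - e.  A circuit C through e gives a
    port element C - e, and a set F of V contains one exactly when e lies in the
    closure of F in M ([port_spanned]), that is, when e is outside the closure
    in N of V - F ([dual_closure]).  So the ideal consists of the polynomials
    whose monomials have their support in an explicit up-set U of subsets of V
    ([steiner_idealP]), and everything can be computed multidegree by
    multidegree, in linear algebra over k.

    For any up-set U, a minimal free resolution is built one module at a time.
    The i-th syzygy module is recorded by its strands in squarefree degrees A,
    which are subspaces increasing with A; its minimal generators of degree A
    form a basis of a complement of what comes from smaller degrees, and the
    relations between them are the next syzygy module.  The entries of the
    differentials are scalars times monomials, exactness can be read on strands
    ([tower_diff_exact]), and complements make them minimal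
    ([resolution_minimal]).  Any other minimal resolution has the same ranks,
    because comparison maps become mutually inverse at the origin
    ([betti_minimal]).  Hence the i-th Betti number is the sum over A of the
    number of generators of degree A of the i-th module ([betti_steiner]).

    That number is controlled by Koszul homology.  The Koszul complex of the
    ideal in degree A is the chain complex of the simplicial complex of the
    subsets S of A with A - S in U.  Shifting dimension along the resolution,
    its exactness in degree i implies that there is no generator of degree A in
    step i ([koszul_shift], [nbetti_eq0]).  If it is exact in all degrees but
    one, the number of generators is, up to sign, the Euler characteristic of
    the complex ([nbetti_euler]).

    For the matroid, put X = V - A.  The simplices are the sets S such that X
    together with S does not span e in N.  Deleting and contracting one element
    of A at a time shows that this complex has homology in at most one degree,
    namely the corank of X in N minus one ([exact_avoiding]), and no homology at
    all when X is not a flat, since it is then a cone ([exact_avoiding_loop]).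
    By the crosscut formula, its Euler characteristic is the sum of mu(X, Y)
    over the flats Y avoiding e ([sum_mobius_avoiding]).  All the flats X of a
    given rank contribute with the same sign, which gives the absolute value;
    those containing e contribute 0. *)

(** * Rank and closure in a matroid *)

Section Rank.
Variables (T : finType) (M : matroid T).
Implicit Types (A B X Y S I : {set T}) (x : T).

Local Open Scope nat_scope.

Lemma rk_ge I A : I \in indep M -> I \subset A -> #|I| <= rk M A.
Proof.
move=> iI sIA; rewrite /rk.
by apply: (@leq_bigmax_cond _ _ (fun B => #|B|)); rewrite iI.
Qed.

Lemma rk_witness A :
  exists2 I, I \in indep M & I \subset A /\ #|I| = rk M A.
Proof.
have P0 : (set0 \in indep M) && (set0 \subset A) by rewrite indep0 sub0set.
have [|I /andP[iI sI] eqI] := @eq_bigmax_cond _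
  (fun B => (B \in indep M) && (B \subset A)) (fun B => #|B|).
  by apply/card_gt0P; exists set0.
by exists I.
Qed.

Lemma rk_witness_ext I A : I \in indep M -> I \subset A ->
  exists2 J, J \in indep M & [/\ I \subset J, J \subset A & #|J| = rk M A].
Proof.
move=> iI sIA.
pose P := [pred J : {set T} | (J \in indep M) && (J \subset A)].
have PI : P I by rewrite /= iI sIA.
have [J /maxsetP[/andP[iJ sJ] maxJ] sIJ] := maxset_exists PI.
exists J => //; split=> //; apply/eqP; rewrite eqn_leq rk_ge //=.
rewrite leqNgt; have [K iK [sK <-]] := rk_witness A; apply/negP => lt.
have [x /setDP[xK xJ] ixJ] := indep_aug iJ iK lt.
have PxJ : P (x |: J) by rewrite /= ixJ subUset sub1set (subsetP sK).
by move: xJ; rewrite -(maxJ _ PxJ (subsetUr _ _)) setU11.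
Qed.

Lemma rk_mono A B : A \subset B -> rk M A <= rk M B.
Proof.
by have [I iI [sI <-]] := rk_witness A => sAB; apply: rk_ge (subset_trans sI sAB).
Qed.

Lemma rk_card A : rk M A <= #|A|.
Proof. by have [I iI [sI <-]] := rk_witness A; apply: subset_leq_card. Qed.

Lemma rk_indep I : I \in indep M -> rk M I = #|I|.
Proof. by move=> iI; apply/eqP; rewrite eqn_leq rk_card rk_ge. Qed.

Lemma indep_rk I : (I \in indep M) = (rk M I == #|I|).
Proof.
apply/idP/eqP => [/rk_indep//|rI].
have [J iJ [sJ eJ]] := rk_witness I.
suff -> : I = J by [].
by apply/esym/eqP; rewrite eqEcard sJ eJ rI leqnn.
Qed.

Lemma rk_addS x A : rk M (x |: A) <= (rk M A).+1.
Proof.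
have [I iI [sI <-]] := rk_witness (x |: A).
have : #|I :\ x| <= rk M A.
  apply: rk_ge; first exact: indepS (subsetDl _ _) iI.
  by rewrite subDset.
by rewrite (cardsD1 x I); case: (x \in I) => /=; lia.
Qed.

Lemma rk_add x A : rk M A <= rk M (x |: A).
Proof. exact/rk_mono/subsetUr. Qed.

(** An element spanned by A is spanned by every larger set: a maximal independent
    set of x |: B chosen to extend one of B that extends one of A would, if it
    contained x, make x independent from A. *)
Lemma rk_add_mono x A B : A \subset B ->
  rk M (x |: A) = rk M A -> rk M (x |: B) = rk M B.
Proof.
move=> sAB eA; apply/eqP; rewrite eqn_leq rk_add andbT leqNgt.
apply/negP => ltB.
have [I iI [sI cI]] := rk_witness A.
have [J iJ [sIJ sJ cJ]] := rk_witness_ext iI (subset_trans sI sAB).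
have [K iK [sJK sK cK]] := rk_witness_ext iJ (subset_trans sJ (subsetUr [set x] B)).
have xJ : x \in K :\: B.
  rewrite inE; apply/andP; split.
    apply/negP => xB; move: ltB.
    have /setUidPr-> : [set x] \subset B by rewrite sub1set.
    by rewrite ltnn.
  apply/negPn/negP => xK.
  suff : #|K| <= rk M B by rewrite cK leqNgt ltB.
  apply: rk_ge => //; apply/subsetP => y yK; have := subsetP sK _ yK.
  by rewrite !inE => /orP[/eqP yx|//]; rewrite -yx yK in xK.
case/setDP: xJ => xK xB.
have ixI : x |: I \in indep M.
  by apply: indepS iK; rewrite subUset sub1set xK (subset_trans sIJ sJK).
have := rk_ge ixI (setUS [set x] sI).
have xI : x \notin I by apply: contra xB => /(subsetP sI)/(subsetP sAB).
by rewrite eA cardsU1 xI cI add1n ltnn.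
Qed.

Definition closure A := [set x | rk M (x |: A) == rk M A].

Lemma in_closure A x : (x \in closure A) = (rk M (x |: A) == rk M A).
Proof. by rewrite inE. Qed.

Lemma sub_closure A : A \subset closure A.
Proof.
by apply/subsetP => x xA; rewrite in_closure (setUidPr _) // sub1set.
Qed.

Lemma closure_mono A B : A \subset B -> closure A \subset closure B.
Proof.
by move=> sAB; apply/subsetP => x; rewrite !in_closure => /eqP/(rk_add_mono sAB)->.
Qed.

Lemma rk_closureU A B : B \subset closure A -> rk M (A :|: B) = rk M A.
Proof.
move: {2}#|B| (leqnn #|B|) => m; elim: m B => [|m IH] B.
  by rewrite leqn0 cards_eq0 => /eqP-> _; rewrite setU0.
case: (set_0Vmem B) => [->|[x xB]]; first by rewrite setU0.
rewrite (cardsD1 x) xB ltnS => le sB.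
have -> : A :|: B = x |: (A :|: B :\ x) by rewrite setUCA setD1K.
have := subsetP sB _ xB; rewrite in_closure => /eqP/rk_add_mono-> //; last first.
  exact: subsetUl.
by apply: IH => //; apply: subset_trans sB; apply: subsetDl.
Qed.

Lemma rk_closure A : rk M (closure A) = rk M A.
Proof. by rewrite -(rk_closureU (subxx (closure A))) (setUidPr _) ?sub_closure. Qed.

Lemma flatP X : reflect (closure X = X) (X \in flats M).
Proof.
rewrite inE; apply: (iffP forallP) => [H|H x].
  apply/eqP; rewrite eqEsubset sub_closure andbT; apply/subsetP => x.
  rewrite in_closure; apply: contraLR => xX.
  by have := H x; rewrite xX /= neq_ltn => ->; rewrite orbT.
apply/implyP; rewrite -{1}H in_closure => xX.
by rewrite ltn_neqAle eq_sym xX rk_add.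
Qed.

Lemma closure_closure A : closure (closure A) = closure A.
Proof.
apply/eqP; rewrite eqEsubset sub_closure andbT; apply/subsetP => x.
rewrite !in_closure rk_closure => /eqP H.
rewrite eqn_leq rk_add andbT -H; exact/rk_mono/setUS/sub_closure.
Qed.

Lemma closure_flat A : closure A \in flats M.
Proof. exact/flatP/closure_closure. Qed.

Lemma closure_sub_flat A X : X \in flats M -> (closure A \subset X) = (A \subset X).
Proof.
move=> /flatP fX; apply/idP/idP => [|sA]; first exact/subset_trans/sub_closure.
by rewrite -fX closure_mono.
Qed.

End Rank.

(** * Dual rank and ports *)

Section DualRank.
Variables (T : finType) (M : matroid T).
Implicit Types (A B X Y S I : {set T}) (x : T).
Local Open Scope nat_scope.

Lemma card_basis B : B \in bases M -> #|B| = rk M setT.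
Proof.
move=> bB; apply/eqP; rewrite eqn_leq rk_ge ?basis_indep ?subsetT //=.
have [I iI [_ <-]] := rk_witness M setT.
exact: (leq_card_basis iI bB).
Qed.

Lemma full_basis I : I \in indep M -> #|I| = rk M setT -> I \in bases M.
Proof.
move=> iI cI; rewrite inE; apply/maxsetP; split=> // J iJ sIJ.
by apply/esym/eqP; rewrite eqEcard sIJ cI rk_ge // subsetT.
Qed.

(** A maximal dually independent subset of A is A - B for a basis B of M meeting
    the complement of A as much as possible. *)
Lemma dual_rk A : rk (dual M) A + rk M setT = #|A| + rk M (~: A).
Proof.
apply/eqP; rewrite eqn_leq; apply/andP; split.
  have [I] := rk_witness (dual M) A.
  rewrite inE => /exists_inP[B bB sIB] [sIA <-].
  have : #|B :\: A| <= rk M (~: A).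
    apply: rk_ge; first exact: indepS (subsetDl _ _) (basis_indep bB).
    by rewrite setDE subsetIr.
  rewrite -(card_basis bB) -(cardsID A B).
  have : #|I| + #|B :&: A| <= #|A|; last by lia.
  rewrite -cardsUI (_ : I :&: (B :&: A) = set0).
    by rewrite cards0 addn0 subset_leq_card // subUset sIA subsetIr.
  apply/setP => x; rewrite !inE; case: (boolP (x \in I)) => //= /(subsetP sIB).
  by rewrite inE => /negPf->.
have [I iI [sI cI]] := rk_witness M (~: A).
have [B iB [sIB _ cB]] := rk_witness_ext iI (subsetT I).
have bB := full_basis iB cB.
have : #|A :\: B| <= rk (dual M) A.
  apply: rk_ge; last exact: subsetDl.
  by rewrite inE; apply/exists_inP; exists B => //; rewrite setDE subsetIr.
rewrite -cI -cB -(cardsID B A) -(cardsID A B) setIC.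
have : #|I| <= #|B :\: A|; last by lia.
apply: subset_leq_card; apply/subsetP => x xI; rewrite inE (subsetP sIB) // andbT.
by have := subsetP sI _ xI; rewrite inE.
Qed.

(** If e is spanned by F, it is spanned by an independent subset I of F, and the
    circuit contained in e |: I must pass through e. *)
Lemma port_spanned e (F : {set T}) : e \notin F ->
  (exists2 P, P \in port M e & P \subset F) <-> e \in closure M F.
Proof.
move=> eF; rewrite in_closure; split.
  move=> [P /imsetP[C]]; rewrite !inE => /andP[/minsetP[dC minC] eC ->] sC.
  apply/eqP/(rk_add_mono sC); rewrite setD1K //.
  have iCe : C :\ e \in indep M.
    apply/negPn/negP => /minC/(_ (subsetDl _ _)) eqC.
    by move: eC; rewrite -eqC !inE eqxx.
  apply/eqP; rewrite (rk_indep iCe) eqn_leq -{2}(rk_indep iCe) rk_mono ?subsetDl // andbT.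
  rewrite /= indep_rk in dC.
  by have := rk_card M C; rewrite leq_eqVlt (negPf dC) /= (cardsD1 e C) eC.
move=> /eqP rF; have [I iI [sI cI]] := rk_witness M F.
have dI : e |: I \notin indep M.
  apply/negP => iI'; have := rk_ge iI' (setUS [set e] sI).
  have eI : e \notin I by apply: contra eF => /(subsetP sI).
  by rewrite cardsU1 eI rF cI ltnn.
have [C minC sCI] := @minset_exists _ [pred A | A \notin indep M] _ dI.
have eC : e \in C.
  apply: contraT => eC; have /minsetP[/= /negP[]] := minC.
  apply: indepS iI; apply/subsetP => x xC; have := subsetP sCI _ xC.
  by rewrite !inE => /orP[/eqP xe|//]; rewrite -xe xC in eC.
exists (C :\ e); first by apply/imsetP; exists C => //; rewrite !inE eC minC.
by rewrite subDset (subset_trans sCI) // setUS.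
Qed.

(** Both sides say that adding e does not raise the rank of F in M: by [dual_rk]
    it then raises the dual rank of the complement. *)
Lemma dual_closure e (F : {set T}) : e \notin F ->
  (e \in closure M F) = (e \notin closure (dual M) (~: (e |: F))).
Proof.
move=> eF; rewrite !in_closure.
have := dual_rk (~: (e |: F)); rewrite setCK.
have -> : e |: ~: (e |: F) = ~: F.
  by apply/setP => x; rewrite !inE; case: eqP => // ->; rewrite eF.
have := dual_rk (~: F); rewrite setCK.
have : #|~: F| = #|~: (e |: F)|.+1.
  by have := cardsC (e |: F); have := cardsC F; rewrite cardsU1 eF; lia.
by have := rk_add M e F; have := rk_addS M e F; lia.
Qed.
End DualRank.

(** * The crosscut formula for the Moebius function *)

Section AlternatingSums.
Variable T : finType.
Implicit Types (A B S : {set T}).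

Lemma sum_subsets_split (R : nmodType) (F : {set T} -> R) A a : a \in A ->
  \sum_(S : {set T} | S \subset A) F S
  = \sum_(S : {set T} | S \subset A :\ a) (F S + F (a |: S)).
Proof.
move=> aA; rewrite (bigID (fun S => a \in S)) /= addrC big_split /=; congr (_ + _).
  by apply: eq_bigl => S; rewrite subsetD1.
rewrite (reindex_onto (fun S => a |: S) (fun S => S :\ a)) /=; last first.
  by move=> S /andP[_ aS]; rewrite setD1K.
apply: eq_bigl => S; rewrite subUset sub1set aA setU11 andbT subsetD1 /=.
congr (_ && _); apply/eqP/idP => [<-|aS]; first by rewrite !inE eqxx.
by rewrite setU1K.
Qed.

Lemma alternating_subsets A :
  \sum_(S : {set T} | S \subset A) (-1) ^+ #|S| = (A == set0)%:R :> int.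
Proof.
case: (set_0Vmem A) => [->|[a aA]].
  rewrite eqxx (big_pred1 set0) => [|S]; last by rewrite subset0.
  by rewrite cards0 expr0.
rewrite (sum_subsets_split _ aA) big1 => [|S]; last first.
  by rewrite subsetD1 => /andP[_ aS]; rewrite cardsU1 aS add1n exprS mulN1r subrr.
by case: eqP aA => // ->; rewrite inE.
Qed.

End AlternatingSums.

Section Crosscut.
Variables (T : finType) (M : matroid T).
Implicit Types (A B S X Y Z : {set T}).

Definition crosscut X Y : int :=
  \sum_(S : {set T} | (S \subset ~: X) && (closure M (X :|: S) == Y)) (-1) ^+ #|S|.

(** The crosscut sums satisfy the recursion that defines the Moebius function:
    collecting the sets S by the flat that they span with X leaves the
    alternating sum over all the subsets of Y - X. *)
Lemma sum_crosscut X Y : Y \in flats M -> X \subset Y ->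
  \sum_(Z in flats M | (X \subset Z) && (Z \subset Y)) crosscut X Z
  = (Y \subset X)%:R.
Proof.
move=> fY sXY; rewrite -setD_eq0 -alternating_subsets.
rewrite [RHS](partition_big (fun S => closure M (X :|: S))
  (fun Z => (Z \in flats M) && ((X \subset Z) && (Z \subset Y)))) /=.
  apply: eq_bigr => Z /and3P[fZ sXZ sZY]; apply: eq_bigl => S.
  case: eqP => [eZ|_]; rewrite ?andbF ?andbT //.
  rewrite subsetD -disjoints_subset.
  case: (boolP [disjoint S & X]) => _; rewrite ?andbF ?andbT //.
  apply/esym/(subset_trans _ sZY).
  by rewrite -eZ (subset_trans (subsetUr X S)) // sub_closure.
move=> S; rewrite subsetD => /andP[sSY _].
rewrite closure_flat closure_sub_flat // subUset sXY sSY !andbT.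
exact: subset_trans (subsetUl X S) (sub_closure M _).
Qed.

Lemma mobius_crosscut X Y : X \in flats M -> Y \in flats M ->
  mobius (flats M) X Y = crosscut X Y.
Proof.
move=> fX; have [m] := ubnP #|Y|; elim: m Y => // m IH Y leY fY.
rewrite mobiusE; case: (boolP (X \subset Y)) => [sXY|nXY]; last first.
  case: eqP nXY => [->|_ nXY]; first by rewrite subxx.
  rewrite /crosscut big1 // => S /andP[_ /eqP eY]; case/negP: nXY; rewrite -eY.
  exact: subset_trans (subsetUl X S) (sub_closure M _).
have := sum_crosscut fY sXY.
rewrite (bigD1 Y) /=; last by rewrite fY sXY subxx.
have -> : \sum_(Z | (Z \in flats M) && ((X \subset Z) && (Z \subset Y)) &&
    (Z != Y)) crosscut X Z
  = \sum_(Z in flats M | (X \subset Z) && (Z \proper Y)) mobius (flats M) X Z.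
  apply: eq_big => [Z|Z /andP[/and3P[fZ _ sZY] neZY]].
    rewrite properEneq; case: (Z \in _); case: (Z \subset Y) => //=;
    by case: (X \subset Z); case: (Z != Y).
  rewrite IH //; rewrite ltnS in leY; apply: leq_trans leY.
  by rewrite proper_card // properEneq neZY.
rewrite (eqEsubset X) sXY /=; case: (boolP (Y \subset X)) => sYX /=.
  rewrite big1 ?addr0 // => Z /and3P[_ sXZ /properP[_ [y yY yZ]]].
  by case/negP: yZ; apply/(subsetP sXZ)/(subsetP sYX).
by move=> /eqP; rewrite addr_eq0 => /eqP.
Qed.

(** Grouping the sets S by the flat Y spanned by X and S turns the right-hand
    side into a sum of crosscut sums.  It is the Euler characteristic of the
    simplicial complex studied in [exact_avoiding]. *)
Lemma sum_mobius_avoiding e X : X \in flats M ->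
  \sum_(Y in flats M | e \notin Y) mobius (flats M) X Y
  = \sum_(S : {set T} | (S \subset ~: X) && (e \notin closure M (X :|: S)))
      (-1) ^+ #|S|.
Proof.
move=> fX; rewrite [RHS](partition_big (fun S => closure M (X :|: S))
  (fun Y => (Y \in flats M) && (e \notin Y))) /=; last first.
  by move=> S /andP[_ eS]; rewrite closure_flat eS.
apply: eq_bigr => Y /andP[fY eY]; rewrite mobius_crosscut //.
apply: eq_bigl => S; case: eqP => [->|]; by rewrite ?andbF // eY !andbT.
Qed.

End Crosscut.

(** * Chains on the subsets of an ordered set *)

Section SimplicialChains.
Variables (k : fieldType) (n : nat) (L : lmodType k).
Implicit Types (S : {set 'I_n}) (a b : 'I_n) (z w : {set 'I_n} -> L).

(** The sign of the face S in the boundary of a |: S, for the natural order on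
    the vertices. *)
Definition sgn a S : k := (-1) ^+ #|[set b in S | (b < a)%N]|.

Lemma sgnK a S : sgn a S * sgn a S = 1.
Proof. by rewrite /sgn -exprD addnn -muln2 mulnC exprM sqrrN !expr1n. Qed.

Lemma sgnU a b S : b \notin S -> sgn a (b |: S) = (-1) ^+ (b < a)%N * sgn a S.
Proof.
move=> bS; rewrite /sgn -exprD; congr (_ ^+ _).
case: ltnP => ba.
  rewrite -(_ : b |: [set c in S | (c < a)%N] = [set c in b |: S | (c < a)%N]).
    by rewrite cardsU1 !inE (negPf bS).
  by apply/setP => c; rewrite !inE; case: eqP => // ->; rewrite ba.
apply: eq_card => c; rewrite !inE; case: eqP => // ->.
by rewrite ltnNge ba (negPf bS).
Qed.

Lemma sgn_swap a b S : a != b -> a \notin S -> b \notin S ->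
  sgn b S * sgn a (b |: S) = - (sgn a S * sgn b (a |: S)).
Proof.
move=> ab aS bS; rewrite !sgnU // mulrCA [sgn a S * _]mulrCA [sgn b S * _]mulrC.
by move: ab; rewrite -val_eqE /= neq_ltn => /orP[] lt; rewrite lt ltnNge (ltnW lt) /=;
  rewrite !(expr0, expr1, mul1r, mulN1r, opprK).
Qed.

Lemma sgn_swap2 a b S : a != b -> a \notin S -> b \notin S ->
  sgn b (a |: S) * sgn a (b |: S) = - (sgn a S * sgn b S).
Proof.
move=> ab aS bS.
rewrite -[sgn a (b |: S)]mul1r -(sgnK b S) -[_ * _ * sgn a _]mulrA sgn_swap //.
by rewrite -[RHS]mulr1 -(sgnK b (a |: S)); ring.
Qed.

(** Chains are functions on all subsets; the coefficient on S of the boundary is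
    collected from the cofaces of S. *)
Definition boundary z S : L := \sum_(a | a \notin S) sgn a S *: z (a |: S).

Definition cone a z S : L :=
  if a \in S then sgn a (S :\ a) *: z (S :\ a) else 0.

Definition link a z S : L :=
  if a \in S then 0 else sgn a S *: z (a |: S).

Lemma boundary_boundary z S : boundary (boundary z) S = 0.
Proof.
(* The terms for (a, b) and (b, a) cancel; they are paired by comparing a and b,
   so that no division by 2 is needed. *)
pose t a b := (sgn a S * sgn b (a |: S)) *: z (b |: (a |: S)).
have tN a b : a \notin S -> b \notin S -> a != b -> t a b = - t b a.
  by move=> aS bS ab; rewrite /t -scaleNr -sgn_swap 1?eq_sym // setUCA.
have -> : boundary (boundary z) S =
  \sum_(a | a \notin S) \sum_(b | b \notin S)
    ((if (a < b)%N then t a b else 0) + (if (b < a)%N then t a b else 0)).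
  rewrite /boundary; apply: eq_bigr => a aS; rewrite scaler_sumr.
  rewrite (bigID (fun b => b == a)) /= [in RHS](bigID (fun b => b == a)) /=.
  congr (_ + _).
    rewrite big1 => [|b /andP[bS /eqP eba]]; last by move: bS; rewrite eba setU11.
    by rewrite big1 // => b /andP[_ /eqP->]; rewrite ltnn addr0.
  apply: eq_big => [b|b]; first by rewrite !inE negb_or; case: eqP; rewrite ?andbF.
  rewrite !inE negb_or => /andP[/andP[ba bS] _]; rewrite scalerA -/(t a b).
  move: ba; rewrite -val_eqE /= neq_ltn => /orP[] lt;
  by rewrite lt ltnNge (ltnW lt) /= ?add0r ?addr0.
rewrite (eq_bigr (fun a => \sum_(b | b \notin S) (if (a < b)%N then t a b else 0)
    + \sum_(b | b \notin S) (if (b < a)%N then t a b else 0)));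
  last by move=> a _; apply: big_split.
rewrite big_split /= [X in _ + X]exchange_big /= -big_split big1 // => a aS /=.
rewrite -big_split big1 // => b bS /=; case: ifP => [lt|_]; last by rewrite addr0.
by rewrite tN ?addNr // -val_eqE /= neq_ltn lt.
Qed.

(** Coning over a vertex is a contracting homotopy of the full simplex, and hence
    of any subcomplex stable under adding that vertex. *)
Lemma cone_boundary a z S : boundary (cone a z) S + cone a (boundary z) S = z S.
Proof.
rewrite /boundary /cone; case: (boolP (a \in S)) => aS; last first.
  rewrite addr0 (bigD1 a) //= big1 => [|b /andP[bS ba]].
    by rewrite setU11 setU1K // scalerA sgnK scale1r addr0.
  by rewrite !inE eq_sym (negPf ba) (negPf aS) scaler0.
pose S' := S :\ a; have aS' : a \notin S' by rewrite !inE eqxx.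
rewrite -/S' -(setD1K aS) -/S' scaler_sumr.
rewrite [X in _ + X](bigD1 a) //= scalerA sgnK scale1r addrCA.
rewrite -[RHS]addr0; congr (_ + _).
rewrite [X in _ + X](eq_bigl (fun b => b \notin a |: S')); last first.
  by move=> b; rewrite !inE negb_or andbC.
rewrite -big_split big1 //= => b; rewrite in_setU1 negb_or => /andP[ba bS'].
rewrite !inE eqxx orbT setUCA setU1K; last by rewrite !inE negb_or eq_sym ba eqxx.
by rewrite !scalerA sgn_swap2 1?eq_sym // scaleNr addNr.
Qed.

Lemma link_boundary a z S : boundary (link a z) S = - link a (boundary z) S.
Proof.
rewrite /boundary /link; case: (boolP (a \in S)) => aS.
  by rewrite big1 ?oppr0 // => b _; rewrite !inE aS orbT scaler0.
rewrite (bigD1 a) //= setU11 scaler0 add0r scaler_sumr -sumrN.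
apply: eq_big => [b|b]; first by rewrite !inE negb_or andbC.
move=> /andP[bS ba]; rewrite !inE (negPf aS) eq_sym (negPf ba) /= !scalerA -scaleNr.
by rewrite -sgn_swap 1?eq_sym // setUCA.
Qed.

Lemma cone_link a z S : cone a (link a z) S = if a \in S then z S else 0.
Proof.
rewrite /cone /link; case: ifP => // aS.
by rewrite !inE eqxx /= scalerA sgnK scale1r setD1K.
Qed.

Lemma eq_boundary z w S : z =1 w -> boundary z S = boundary w S.
Proof. by move=> zw; apply: eq_bigr => a _; rewrite zw. Qed.

Lemma eq_cone a z w S : z =1 w -> cone a z S = cone a w S.
Proof. by move=> zw; rewrite /cone zw. Qed.

Lemma boundary0 S : boundary (fun=> 0) S = 0.
Proof. by rewrite /boundary big1 // => a _; rewrite scaler0. Qed.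

Lemma boundaryD z w S : boundary (fun S => z S + w S) S = boundary z S + boundary w S.
Proof. by rewrite /boundary -big_split; apply: eq_bigr => a _; rewrite scalerDr. Qed.

Lemma boundaryB z w S : boundary (fun S => z S - w S) S = boundary z S - boundary w S.
Proof. by rewrite /boundary -sumrB; apply: eq_bigr => a _; rewrite scalerBr. Qed.

(** A complex is given by the condition [C S v] that a coefficient v must satisfy
    to sit on the simplex S; this covers simplicial chains ([simplices]) and
    Koszul chains with coefficients in a module ([koszul]) alike.  The degree j
    is the number of vertices, so that the empty simplex has degree 0. *)
Definition chain (C : {set 'I_n} -> L -> Prop) j z :=
  forall S, C S (z S) /\ (z S != 0 -> #|S| = j).

Definition exact_at (C : {set 'I_n} -> L -> Prop) j :=
  forall z, chain C j z -> boundary z =1 (fun=> 0) ->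
  exists2 w, chain C j.+1 w & boundary w =1 z.

Definition simplices (K : pred {set 'I_n}) (S : {set 'I_n}) (v : L) : Prop :=
  v != 0 -> K S.

Lemma chain_simplices K j z :
  chain (simplices K) j z <-> forall S, z S != 0 -> K S /\ #|S| = j.
Proof.
split=> [H S zS|H S]; first by have [h1 h2] := H S; split; [apply: h1|apply: h2].
by split=> zS; have [] := H S zS.
Qed.

(** A cone is acyclic, by the homotopy [cone_boundary]. *)
Lemma exact_cone (K : pred {set 'I_n}) a j :
  (forall S, K S -> K (a |: S)) -> exact_at (simplices K) j.
Proof.
move=> Ka z /chain_simplices cz bz; exists (cone a z).
  apply/chain_simplices => S; rewrite /cone; case: ifP => [aS|]; last by rewrite eqxx.
  have [->|/cz[KS cS] _] := eqVneq (z (S :\ a)) 0; first by rewrite scaler0 eqxx.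
  by rewrite (cardsD1 a) aS cS -(setD1K aS); split; first exact: Ka.
move=> S; rewrite -[RHS](cone_boundary a z S) (@eq_cone _ (boundary z) (fun=> 0)) //.
by rewrite {3}/cone; case: ifP; rewrite ?scaler0 addr0.
Qed.

(** The long exact sequence of deletion and link of the vertex a, at one spot: the
    part of a cycle through a is a cycle of the link, where it bounds w1; adding
    the boundary of the cone over w1 leaves a cycle of the deletion.  The
    predecessor in the last hypothesis is the degree shift of the link. *)
Lemma exact_del_link (K : pred {set 'I_n}) a j :
  (forall S, K (a |: S) -> K S) ->
  exact_at (simplices [pred S : {set 'I_n} | (a \notin S) && K S]) j ->
  (forall i, j = i.+1 ->
    exact_at (simplices [pred S : {set 'I_n} | (a \notin S) && K (a |: S)]) i) ->
  exact_at (simplices K) j.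
Proof.
move=> Ka Hdel Hlink z /chain_simplices cz bz.
have [w1 cw1 bw1] : exists2 w, boundary w =1 link a z
    & forall S, w S != 0 -> [/\ a \notin S, K (a |: S) & #|S| = j].
  case: j cz Hlink {Hdel} => [|j] cz Hlink.
    exists (fun=> 0) => S; last by rewrite eqxx.
    rewrite boundary0 /link; case: ifP => // aS.
    have [->|/cz[_]] := eqVneq (z (a |: S)) 0; first by rewrite scaler0.
    by rewrite cardsU1 aS.
  have [||w cw bw] := Hlink j erefl (link a z).
  - apply/chain_simplices => S; rewrite /link.
    case: ifP => [|aS]; first by rewrite eqxx.
    have [->|/cz[KS]] := eqVneq (z (a |: S)) 0; first by rewrite scaler0 eqxx.
    by rewrite cardsU1 aS add1n => -[cS]; rewrite /= aS KS.
  - by move=> S; rewrite link_boundary /link bz scaler0 if_same oppr0.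
  exists w => // S wS; have /chain_simplices/(_ S wS)[/andP[]] := cw; by [].
have bcw S : boundary (cone a w1) S = w1 S - (if a \in S then z S else 0).
  rewrite -[w1 S](cone_boundary a) -(cone_link a z) -(eq_cone _ _ cw1).
  by rewrite addrK.
have [||y cy byy] := Hdel (fun S => z S + boundary (cone a w1) S).
- apply/chain_simplices => S; rewrite bcw /=.
  case: (boolP (a \in S)) => aS.
    rewrite addrC subrK => /bw1[]; by rewrite aS.
  rewrite subr0; have [->|/cz//] := eqVneq (z S) 0.
  by rewrite add0r => /bw1[_ /Ka].
- by move=> S; rewrite boundaryD bz boundary_boundary addr0.
exists (fun S => y S - cone a w1 S); last by move=> S; rewrite boundaryB byy addrK.
apply/chain_simplices => S.
have [->|/(proj1 (chain_simplices _ _ _) cy)[/andP[_ KS] cS]] := eqVneq (y S) 0;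
  last by [].
rewrite add0r oppr_eq0 /cone; case: ifP => [aS|]; last by rewrite eqxx.
have [->|/bw1[_]] := eqVneq (w1 (S :\ a)) 0; first by rewrite scaler0 eqxx.
by rewrite setD1K // (cardsD1 a S) aS => -> ->.
Qed.

End SimplicialChains.

(** * Acyclicity of the sets that do not span an element *)

Lemma eq_exact_simplices (k : fieldType) (n : nat) (L : lmodType k)
    (K K' : pred {set 'I_n}) j : K =1 K' ->
  exact_at (@simplices k n L K) j -> exact_at (@simplices k n L K') j.
Proof.
move=> eK H z /chain_simplices cz bz.
have [|w /chain_simplices cw bw] := H z _ bz.
  by apply/chain_simplices => S; rewrite eK; apply: cz.
by exists w => //; apply/chain_simplices => S; rewrite -eK; apply: cw.
Qed.

Section MatroidVanishing.
Variables (k : fieldType) (L : lmodType k) (E : finType) (N : matroid E) (e : E).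
Variables (n : nat) (g : 'I_n -> E).
Implicit Types (B X W S C : {set 'I_n}) (a : 'I_n).

Definition avoids C := e \notin closure N (g @: C).

(** X is the set of contracted elements and W the set of remaining ones, so that
    the deletion and the link of a vertex are again complexes of this form. *)
Definition avoiding_complex X W : pred {set 'I_n} :=
  [pred S : {set 'I_n} | (S \subset W) && avoids (X :|: S)].

Lemma avoids_anti B C : B \subset C -> avoids C -> avoids B.
Proof. by move=> sBC; apply: contra => /(subsetP (closure_mono N (imsetS g sBC))). Qed.

(** Here a is a loop after contracting X: adding it never changes the closure, so
    the complex is a cone over a. *)
Lemma exact_avoiding_loop X W a j : a \in W ->
  g a \in closure N (g @: X) ->
  exact_at (@simplices k n L (avoiding_complex X W)) j.
Proof.
move=> aW; rewrite in_closure => /eqP loop.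
apply: (@exact_cone _ _ _ _ a) => S /andP[sSW avS].
rewrite /avoiding_complex /= subUset sub1set aW sSW /=.
rewrite setUCA /avoids imsetU1 in_closure setUCA.
have sX (Y : {set E}) : g @: X \subset Y -> rk N (g a |: Y) = rk N Y.
  by move=> sXY; apply: rk_add_mono loop.
have sXS : g @: X \subset g @: (X :|: S) by apply/imsetS/subsetUl.
rewrite !sX // -?in_closure //; exact: subset_trans sXS (subsetUr _ _).
Qed.

(** Induction on W.  If a is a loop or a coloop, the complex is a cone over a.
    Otherwise deleting a preserves the rank, while contracting it lowers both
    the rank and the degree by one, so both the deletion and the link are exact
    in the degree needed. *)
Lemma exact_avoiding X W j :
  rk N (e |: g @: (X :|: W)) != (rk N (g @: X) + j.+1)%N ->
  exact_at (@simplices k n L (avoiding_complex X W)) j.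
Proof.
have [m] := ubnP #|W|; elim: m => // m IH in X W j *; rewrite ltnS => leW neW.
case: (set_0Vmem W) => [W0|[a aW]].
  move=> z /chain_simplices cz bz; exists (fun=> 0).
    by apply/chain_simplices => S; rewrite eqxx.
  move=> S; rewrite boundary0; have [->//|/cz[/andP[]]] := eqVneq (z S) 0.
  rewrite W0 subset0 => /eqP-> + cS; rewrite cards0 in cS.
  move: neW; rewrite W0 -cS setU0 addn1 /avoids in_closure.
  by have := rk_add N e (g @: X); have := rk_addS N e (g @: X); lia.
pose W' := W :\ a; have ltW : (#|W'| < m)%N by move: leW; rewrite (cardsD1 a W) aW.
have addaE C : avoids (a |: C) = (e \notin closure N (g a |: g @: C)).
  by rewrite /avoids imsetU1.
have [loop|nloop] := eqVneq (rk N (g a |: g @: X)) (rk N (g @: X)).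
  by apply: (@exact_avoiding_loop X W a) => //; rewrite in_closure loop.
have [coloop|ncoloop] :=
  eqVneq (rk N (e |: g @: (X :|: W))) (rk N (e |: g @: (X :|: W'))).+1.
  apply: (@exact_cone _ _ _ _ a) => S /andP[sSW avS].
  rewrite /avoiding_complex /= subUset sub1set aW sSW /=.
  case: (boolP (a \in S)) => aS.
    by have /setUidPr-> : [set a] \subset S by rewrite sub1set.
  have sS : e |: g @: (X :|: S) \subset e |: g @: (X :|: W').
    by apply/setUS/imsetS/setUS; rewrite subsetD1 sSW aS.
  have incr (Y : {set E}) : Y \subset e |: g @: (X :|: W') ->
      rk N (g a |: Y) = (rk N Y).+1.
    move=> sY; apply/eqP; rewrite eqn_leq rk_addS /= ltn_neqAle rk_add andbT eq_sym.
    apply/negP => /eqP/(rk_add_mono sY); move: coloop.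
    rewrite -(setD1K aW) -/W' [X :|: _]setUCA imsetU1 setUCA => -> /eqP.
    by rewrite eqn_leq ltnn.
  rewrite setUCA addaE in_closure setUCA !incr ?eqSS -?in_closure //.
  exact: subset_trans (subsetUr _ _) sS.
have eqW : rk N (e |: g @: (X :|: W')) = rk N (e |: g @: (X :|: W)).
  move: ncoloop; rewrite -(setD1K aW) -/W' [X :|: (_ |: _)]setUCA imsetU1 setUCA.
  move=> ncoloop.
  by apply/eqP; rewrite eqn_leq rk_add -ltnS ltn_neqAle ncoloop rk_addS.
have eqX : rk N (g @: (a |: X)) = (rk N (g @: X)).+1.
  apply/eqP; rewrite imsetU1 eqn_leq rk_addS ltn_neqAle eq_sym nloop.
  exact: rk_add.
apply: (@exact_del_link _ _ _ _ a) => [S /andP[sS avS]||i ji].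
- rewrite /avoiding_complex /= (subset_trans (subsetUr _ _) sS) /=; apply: avoids_anti avS.
  exact/setUS/subsetUr.
- apply: (eq_exact_simplices _ (IH X W' j ltW _)); last by rewrite eqW.
  by move=> S; rewrite /avoiding_complex /= subsetD1 [X in X && _]andbC -andbA.
- apply: (eq_exact_simplices _ (IH (a |: X) W' i ltW _)).
    move=> S; rewrite /avoiding_complex /= subsetD1 subUset sub1set aW /= setUCA -setUA.
    by rewrite [X in X && _]andbC -andbA.
  by rewrite -setUA -[a |: (X :|: _)]setUCA setD1K // eqX addSnnS -ji.
Qed.

End MatroidVanishing.

(** * Minimal covers of squarefree modules *)

Section FreeStrand.
Variables (k : fieldType) (n m : nat) (deg : 'I_m -> {set 'I_n}).
Implicit Types (A B : {set 'I_n}) (v w : 'rV[k]_m).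

(** The strand of degree A of the free module on generators of degrees [deg]: the
    span of the generators whose degree is contained in A. *)
Definition free_strand A : 'M[k]_m := diag_mx (\row_q (deg q \subset A)%:R).

Lemma sub_free_strand v A :
  reflect (forall q, v 0 q != 0 -> deg q \subset A) (v <= free_strand A)%MS.
Proof.
apply: (iffP idP) => [/submxP[D ->] q|H].
  by rewrite mul_mx_diag !mxE; case: (_ \subset _); rewrite ?mulr0 ?eqxx.
apply/submxP; exists v; rewrite mul_mx_diag; apply/rowP => q; rewrite !mxE.
have := H q; case: (boolP (deg q \subset A)) => _; rewrite ?mulr1 // mulr0.
by case: eqP => // _ /(_ isT).
Qed.

Lemma free_strand_mono A B : A \subset B -> (free_strand A <= free_strand B)%MS.
Proof.
move=> sAB; apply/row_subP => i; apply/sub_free_strand => q.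
rewrite row_diag_mx !mxE; case: (boolP (deg i \subset A)) => [sA|_].
  by have [->|_] := eqVneq q i; rewrite ?andbF ?mulr0 ?eqxx // (subset_trans sA).
by rewrite mul0r eqxx.
Qed.

Lemma rank_free_strand A : \rank (free_strand A) = #|[set q | deg q \subset A]|.
Proof.
(* The unit vectors of the generators involved. *)
set Q := [set q | _]; pose P : 'M[k]_(#|Q|, m) := rowsub enum_val 1%:M.
have fP : row_free P.
  apply/row_freeP; exists P^T; apply/matrixP => i j; rewrite !mxE.
  rewrite (bigD1 (enum_val i)) //= big1 => [|q qi]; rewrite !mxE.
    by rewrite eqxx mul1r addr0 eq_sym (inj_eq enum_val_inj) eq_sym.
  by rewrite eq_sym (negPf qi) mul0r.
rewrite -(eqP fP); apply: eqmx_rank; apply/andP; split; apply/row_subP => i.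
  rewrite row_diag_mx mxE; case: (boolP (_ \subset _)) => iA; last first.
    by rewrite scale0r sub0mx.
  have iQ : i \in Q by rewrite inE.
  rewrite scale1r; apply: submx_trans (row_sub (enum_rank_in iQ i) P).
  by rewrite row_rowsub enum_rankK_in // row1.
rewrite row_rowsub row1; apply/sub_free_strand => q; rewrite mxE eqxx /=.
have [-> _|_] := eqVneq q (enum_val i); last by rewrite eqxx.
by have := enum_valP i; rewrite inE.
Qed.

End FreeStrand.

Section MinimalCover.
Variables (k : fieldType) (n f : nat) (Z : {set 'I_n} -> 'M[k]_f).
Implicit Types (A B C S : {set 'I_n}).

(** A squarefree module is given by its strands [Z A], subspaces of a fixed space
    that increase with A.  The part of degree A coming from smaller degrees is
    [decomp A], and a basis of the complement [indecomp A] is a minimal set of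
    generators of degree A. *)
Definition decomp A := (\sum_(a in A) Z (A :\ a))%MS.
Definition indecomp A := (Z A :\: decomp A)%MS.
Definition gens := {A : {set 'I_n} & 'I_(\rank (indecomp A))}.
Definition ngens := #|{: gens}|.
Definition gdeg (q : 'I_ngens) : {set 'I_n} := tag (enum_val q).
Definition cover_mx : 'M[k]_(ngens, f) :=
  \matrix_(q < ngens) row (tagged (enum_val q)) (row_base (indecomp (gdeg q))).
Definition syz A := (kermx cover_mx :&: free_strand k gdeg A)%MS.

Local Notation Fr := (free_strand k gdeg).

Lemma sum_gens (R : nmodType) (F : {set 'I_n} -> R) :
  \sum_(q < ngens) F (gdeg q) = \sum_A F A *+ \rank (indecomp A).
Proof.
under [RHS]eq_bigr do rewrite -[X in _ *+ X]card_ord -sumr_const.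
rewrite sig_big_dep (reindex (@enum_rank gens)); last exact/onW_bij/enum_rank_bij.
by apply: eq_big => [p|p _]; rewrite ?inE // /gdeg enum_rankK.
Qed.

Lemma card_gens (P : pred {set 'I_n}) :
  #|[set q | P (gdeg q)]| = (\sum_(A | P A) \rank (indecomp A))%N.
Proof.
rewrite -sum1_card big_mkcond [RHS]big_mkcond /=.
rewrite (eq_bigr (fun q => (fun A => if P A then 1%N else 0%N) (gdeg q)));
  last by move=> q _; rewrite inE.
have := sum_gens (fun A => if P A then 1%N else 0%N) => /= ->.
by apply: eq_bigr => A _; case: (P A); [exact: natn | exact: mul0rn].
Qed.

Lemma cover_row q : (row q cover_mx <= indecomp (gdeg q))%MS.
Proof. by rewrite rowK -(eq_row_base (indecomp _)) row_sub. Qed.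

Hypothesis Zmono : forall A B, A \subset B -> (Z A <= Z B)%MS.

Lemma sub_decomp A B : B \proper A -> (Z B <= decomp A)%MS.
Proof.
case/properP => sBA [a aA aB]; apply: (sumsmx_sup a) => //.
by rewrite Zmono // subsetD1 sBA aB.
Qed.

Lemma cover_sub A : (Fr A *m cover_mx <= Z A)%MS.
Proof.
apply/row_subP => q; rewrite row_mul row_diag_mx mxE -scalemxAl -rowE.
case: (boolP (gdeg q \subset A)) => [sA|_]; last by rewrite scale0r sub0mx.
by rewrite scale1r (submx_trans (cover_row q)) // (submx_trans (diffmxSl _ _)) ?Zmono.
Qed.

(** Nakayama lemma for squarefree modules: by induction on A, the decomposable
    elements are reached from smaller degrees, the others from generators of
    degree A. *)
Lemma cover_onto A : (Z A <= Fr A *m cover_mx)%MS.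
Proof.
have [m] := ubnP #|A|; elim: m A => // m IH A; rewrite ltnS => leA.
rewrite -(addsmx_diff_cap_eq (Z A) (decomp A)) addsmx_sub; apply/andP; split.
  rewrite -/(indecomp A) -(eq_row_base (indecomp A)); apply/row_subP => i.
  pose p : gens := Tagged (fun A => 'I_(\rank (indecomp A))) i.
  pose q := enum_rank p.
  have -> : row i (row_base (indecomp A)) = row q cover_mx.
    by rewrite rowK /gdeg /q enum_rankK.
  rewrite rowE; apply: submxMr; apply/sub_free_strand => q'; rewrite mxE eqxx /=.
  have [-> _|_] := eqVneq q' q; last by rewrite eqxx.
  by rewrite /gdeg /q enum_rankK.
apply: submx_trans (capmxSr _ _) _; apply/sumsmx_subP => a aA.
apply: submx_trans (IH _ _) _; first by move: leA; rewrite (cardsD1 a A) aA.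
by apply: submxMr; apply/free_strand_mono/subsetDl.
Qed.

Lemma cover_eq A : (Fr A *m cover_mx :=: Z A)%MS.
Proof. by apply/eqmxP; rewrite cover_sub cover_onto. Qed.

(** The generators of degree A are independent modulo the decomposable elements;
    this is what makes the cover minimal. *)
Lemma indecomp_free A (w : 'rV_ngens) :
  (w <= Fr A)%MS -> (w *m cover_mx <= decomp A)%MS -> forall q, gdeg q = A -> w 0 q = 0.
Proof.
move=> /sub_free_strand wA lowA.
(* The part of w on the generators of degree A exactly. *)
pose wt : 'rV_ngens := \row_q (if gdeg q == A then w 0 q else 0).
have lowt : (wt *m cover_mx <= decomp A)%MS.
  have -> : wt = w - (w - wt) by rewrite opprB addrC subrK.
  rewrite mulmxBl addmx_sub // eqmx_opp mulmx_sum_row.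
  apply/summx_sub => q _; rewrite !mxE; case: (eqVneq (gdeg q) A) => [_|neA].
    by rewrite subrr scale0r sub0mx.
  rewrite subr0; have [->|/wA sA] := eqVneq (w 0 q) 0; first by rewrite scale0r sub0mx.
  apply/scalemx_sub/(submx_trans (cover_row q))/(submx_trans (diffmxSl _ _)).
  by apply: sub_decomp; rewrite properEneq neA.
have topt : (wt *m cover_mx <= indecomp A)%MS.
  rewrite mulmx_sum_row; apply/summx_sub => q _; rewrite mxE.
  case: eqP => [<-|_]; last by rewrite scale0r sub0mx.
  exact/scalemx_sub/cover_row.
have wt0 : wt *m cover_mx = 0.
  by apply/eqP; rewrite -submx0 -(capmx_diff (Z A) (decomp A)) sub_capmx topt lowt.
pose x : 'rV_(\rank (indecomp A)) := \row_i
  w 0 (enum_rank (Tagged (fun A => 'I_(\rank (indecomp A))) i : gens)).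
have x0 : x *m row_base (indecomp A) = 0.
  rewrite -[RHS]wt0.
  pose p B i : gens := @Tagged _ B (fun A => 'I_(\rank (indecomp A))) i.
  have -> : wt *m cover_mx = \sum_B \sum_(i < \rank (indecomp B))
      wt 0 (enum_rank (p B i)) *: row (enum_rank (p B i)) cover_mx.
    rewrite mulmx_sum_row sig_big_dep (reindex (@enum_rank gens)) /=; last first.
      exact/onW_bij/enum_rank_bij.
    by apply: eq_bigr => -[].
  rewrite mulmx_sum_row.
  rewrite (bigD1 A) //= [X in _ + X]big1 => [|B neBA]; last first.
    by rewrite big1 // => i _; rewrite mxE /gdeg enum_rankK /= (negPf neBA) scale0r.
  rewrite addr0; apply: eq_bigr => i _.
  by rewrite !mxE rowK /gdeg enum_rankK /= eqxx.
have {}x0 : x = 0.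
  move: x0; rewrite -[RHS](mul0mx _ (row_base (indecomp A))).
  exact: (row_free_inj (row_base_free _)).
move=> q; rewrite /gdeg => qA; move: x0; rewrite -[q]enum_valK.
case: (enum_val q) qA => B i /= eBA; rewrite /x; subst B.
by move/rowP/(_ i); rewrite !mxE.
Qed.

Lemma syz_mono A B : A \subset B -> (syz A <= syz B)%MS.
Proof. by move=> sAB; apply: capmxS => //; apply: free_strand_mono. Qed.

Lemma sub_syz A (v : 'rV_ngens) :
  (v <= syz A)%MS = (v *m cover_mx == 0) && (v <= Fr A)%MS.
Proof. by rewrite sub_capmx; congr (_ && _); apply/sub_kermxP/eqP. Qed.

Lemma syz_minimal A (v : 'rV_ngens) :
  (v <= syz A)%MS -> forall q, gdeg q = A -> v 0 q = 0.
Proof.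
rewrite sub_syz => /andP[/eqP v0 vA]; apply: indecomp_free vA _.
by rewrite v0 sub0mx.
Qed.

(** Rank-nullity for the strand of degree A of the cover. *)
Lemma rank_cover A :
  (\rank (Z A) + \rank (syz A) = \sum_(B : {set 'I_n} | B \subset A) \rank (indecomp B))%N.
Proof.
rewrite -card_gens -(rank_free_strand k) -(mxrank_mul_ker (Fr A) cover_mx).
by rewrite (cover_eq A) capmxC.
Qed.

End MinimalCover.

(** * Koszul homology and dimension shifting *)

Section KoszulShift.
Variables (k : fieldType) (n f : nat) (Z : {set 'I_n} -> 'M[k]_f).
Implicit Types (A B C S : {set 'I_n}).
Hypothesis Zmono : forall A B, A \subset B -> (Z A <= Z B)%MS.

(** The strand of degree A of the Koszul complex with coefficients in the module
    of strands Y: the exterior monomial of S carries a coefficient of degree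
    A - S. *)
Definition koszul m (Y : {set 'I_n} -> 'M[k]_m) A S (v : 'rV[k]_m) : Prop :=
  v != 0 -> S \subset A /\ (v <= Y (A :\: S)%SET)%MS.

Local Notation Fr := (free_strand k (gdeg (Z := Z))).

(** Koszul homology of a free module sits in degree 0 and in the degrees of the
    generators.  On the coordinate of a generator of degree strictly inside A,
    cone over a vertex of A outside that degree; the hypothesis on z removes the
    coordinates of degree exactly A. *)
Lemma koszul_free A j (z : {set 'I_n} -> 'rV[k]_(ngens Z)) :
  chain (koszul Fr A) j z -> (forall q, gdeg q = A -> forall S, z S 0 q = 0) ->
  boundary z =1 (fun=> 0) -> exists2 w, chain (koszul Fr A) j.+1 w & boundary w =1 z.
Proof.
move=> cz zA bz.
have zS S q : z S 0 q != 0 -> [/\ S \subset A, #|S| = j & gdeg q \subset A :\: S].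
  move=> zq; have [kz cardS] := cz S.
  have z0 : z S != 0 by apply: contraNneq zq => ->; rewrite mxE.
  by have [sSA /sub_free_strand/(_ q zq)] := kz z0; split=> //; apply: cardS.
pose w S : 'rV[k]_(ngens Z) :=
  \row_q (if [pick a in A :\: gdeg q] is Some a then cone a z S 0 q else 0).
exists w => [S|S].
  have wS q : w S 0 q != 0 -> [/\ S \subset A, #|S| = j.+1 & gdeg q \subset A :\: S].
    rewrite mxE; case: pickP => [a /setDP[aA aq]|]; last by rewrite eqxx.
    rewrite /cone; case: ifP => [aS|]; last by rewrite mxE eqxx.
    rewrite mxE mulf_eq0 negb_or => /andP[_ /zS[sS cS sq]]; split.
    - by rewrite -(setD1K aS) subUset sub1set aA.
    - by rewrite (cardsD1 a S) aS cS.
    - apply/subsetP => b bq; have := subsetP sq b bq; rewrite !inE.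
      by case: (eqVneq b a) bq => [->|_ _]; rewrite ?(negPf aq).
  have ex : w S != 0 -> exists q, w S 0 q != 0.
    move=> w0; case: (pickP (fun q => w S 0 q != 0)) => [q|wq]; first by exists q.
    by case/eqP: w0; apply/rowP => q; rewrite [RHS]mxE; apply/eqP/negbFE/wq.
  split=> [w0|/ex[q /wS[]] //]; split; first by have [q /wS[]] := ex w0.
  by apply/sub_free_strand => q /wS[].
apply/rowP => q; rewrite /boundary summxE.
case pq: [pick a in A :\: gdeg q] => [a|]; last first.
  rewrite big1 => [|b _]; last by rewrite !mxE pq mulr0.
  apply/esym/eqP; apply: contraTT isT => /[dup] zq /zS[sSA cS sq].
  move: pq; case: pickP => // Aq _; case/negP: zq; apply/eqP/zA/eqP.
  rewrite eqEsubset (subset_trans sq (subsetDl _ _)) /=.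
  by apply/subsetP => b bA; have := Aq b; rewrite !inE bA andbT => /negbFE.
have := cone_boundary a z S; rewrite (eq_cone _ _ bz) {2}/cone scaler0 if_same addr0.
move/rowP/(_ q) <-; rewrite /boundary summxE; apply: eq_bigr => b _.
by rewrite !mxE pq.
Qed.

Lemma boundary_mulmx m p (D : 'M[k]_(m, p)) (z : {set 'I_n} -> 'rV[k]_m) S :
  boundary (fun S => z S *m D) S = boundary z S *m D.
Proof. by rewrite /boundary mulmx_suml; apply: eq_bigr => a _; rewrite scalemxAl. Qed.

Lemma boundary_neq0 (L : lmodType k) (z : {set 'I_n} -> L) S : boundary z S != 0 ->
  exists2 a, a \notin S & z (a |: S) != 0.
Proof.
move=> bz; case: (pickP (fun a => (a \notin S) && (z (a |: S) != 0))) => [a /andP[]|H].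
  by exists a.
case/eqP: bz; apply: big1 => a aS; have := H a; rewrite aS /= => /negbFE/eqP->.
by rewrite scaler0.
Qed.

(** The connecting map of the sequence from the syzygies to the free cover to Z.
    A cycle z of syzygies bounds some w in the free module; the image of w in Z
    is a cycle, hence bounds some y; correcting w by the boundary of a lift of y
    makes it a chain of syzygies without changing its boundary. *)
Lemma koszul_shift A j :
  exact_at (koszul Z A) j.+1 -> exact_at (koszul (syz Z) A) j.
Proof.
move=> exZ z cz bz.
have [||w cw bw] := @koszul_free A j z _ _ bz.
- move=> S; have [kz cS] := cz S; split=> // z0; have [sSA] := kz z0.
  by rewrite sub_syz // => /andP[].
- move=> q qA S; have [->|z0] := eqVneq (z S) 0; first by rewrite mxE.
  have [/(_ z0)[_ zS] _] := cz S.
  apply: (syz_minimal Zmono _ qA).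
  by apply: submx_trans zS _; apply/syz_mono/subsetDl.
have [||y cy by_] := exZ (fun S => w S *m cover_mx Z).
- move=> S; have [kw cS] := cw S; split=> [wS|wS].
    have w0 : w S != 0 by apply: contraNneq wS => ->; rewrite mul0mx.
    have [sSA wF] := kw w0; split=> //.
    exact: submx_trans (submxMr _ wF) (cover_sub Zmono _).
  by apply: cS; apply: contraNneq wS => ->; rewrite mul0mx.
- move=> S; rewrite boundary_mulmx bw.
  have [->|z0] := eqVneq (z S) 0; first exact: mul0mx.
  by have [/(_ z0)[_]] := cz S; rewrite sub_syz // => /andP[/eqP].
pose y' S := y S *m pinvmx (Fr (A :\: S) *m cover_mx Z) *m Fr (A :\: S).
have y'K S : y' S *m cover_mx Z = y S.
  have [yS|yS] := eqVneq (y S) 0; first by rewrite /y' yS !mul0mx.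
  rewrite /y' -mulmxA mulmxKpV //; have [/(_ yS)[_ yZ] _] := cy S.
  exact: submx_trans yZ (cover_onto _ _).
have y'0 S : y' S != 0 -> S \subset A /\ #|S| = j.+2.
  move=> y'S; have y0 : y S != 0 by apply: contraNneq y'S => yS; rewrite /y' yS !mul0mx.
  by have [/(_ y0)[sSA _] /(_ y0)] := cy S.
exists (fun S => w S - boundary y' S) => S; last first.
  by rewrite boundaryB bw boundary_boundary subr0.
have u0 : w S - boundary y' S != 0 -> S \subset A /\ #|S| = j.+1.
  have [w0|w0 _] := eqVneq (w S) 0.
    rewrite w0 sub0r oppr_eq0 => /boundary_neq0[a aS /y'0[sA]].
    rewrite cardsU1 aS add1n => -[->]; split=> //.
    exact: subset_trans (subsetUr _ _) sA.
  by have [/(_ w0)[sSA _] /(_ w0)] := cw S.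
split=> [/u0[sSA _]|/u0[]//]; split=> //; rewrite sub_syz //; apply/andP; split.
  by rewrite mulmxBl -boundary_mulmx (eq_boundary _ y'K) by_ subrr.
rewrite addmx_sub ?eqmx_opp //.
  have [->|w0] := eqVneq (w S) 0; first exact: sub0mx.
  by have [/(_ w0)[]] := cw S.
apply/summx_sub => a aS; apply/scalemx_sub/(submx_trans (submxMl _ _)).
by apply/free_strand_mono/setDS/subsetUr.
Qed.

(** Koszul homology in degree 0 is the module modulo its decomposable part. *)
Lemma no_indecomp A : exact_at (koszul Z A) 0 -> \rank (indecomp Z A) = 0.
Proof.
move=> exZ; suff ZL : (Z A <= decomp Z A)%MS.
  apply/eqP; rewrite mxrank_eq0 -submx0 -(capmx_diff (Z A) (decomp Z A)).
  rewrite sub_capmx submx_refl.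
  exact: submx_trans (diffmxSl _ _) ZL.
apply/row_subP => i; pose v := row i (Z A).
have [||w cw bw] := exZ (fun S => if S == set0 then v else 0).
- move=> S; have [->|_] := eqVneq S set0; last by split; rewrite ?eqxx // => /eqP.
  by split; rewrite ?cards0 // => _; rewrite sub0set setD0 row_sub.
- move=> S; rewrite /boundary big1 // => a aS.
  have [/setP/(_ a)|_] := eqVneq (a |: S) set0.
    by rewrite !inE eqxx.
  by rewrite scaler0.
rewrite -/v; have := bw set0; rewrite eqxx => <-.
apply/summx_sub => a _; apply: scalemx_sub; rewrite setU0.
have [->|w0] := eqVneq (w [set a]) 0; first exact: sub0mx.
have [/(_ w0)[]] := cw [set a]; rewrite sub1set => aA wZ _.
exact: (sumsmx_sup a).
Qed.
End KoszulShift.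

(** * The minimal resolution of an up-set *)

Section MinimalResolution.
Variables (k : fieldType) (n : nat) (U : {set {set 'I_n}}).
Implicit Types (A B C S : {set 'I_n}).
Hypothesis Uup : forall A B, A \subset B -> A \in U -> B \in U.

Record stage := Stage { stage_rank : nat; strands : {set 'I_n} -> 'M[k]_(stage_rank) }.

(** Stage 0 is the ideal itself, as a submodule of the ring; stage i.+1 is the
    module of relations between the minimal generators of stage i, inside the
    free module on these generators. *)
Fixpoint tower i : stage :=
  if i is i'.+1 then Stage (syz (strands (tower i')))
  else @Stage 1 (fun A => (A \in U)%:R%:M).

Lemma scalar_mx0 m : (false%:R : k)%:M = 0 :> 'M_m.
Proof. by apply/matrixP => i j; rewrite !mxE mul0rn. Qed.

Lemma tower_mono i A B : A \subset B -> (strands (tower i) A <= strands (tower i) B)%MS.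
Proof.
case: i => [|i] sAB /=; last exact: syz_mono.
by case: (boolP (A \in U)) => [/(Uup sAB)->//|_]; rewrite scalar_mx0 sub0mx.
Qed.

(** The multigraded Betti number. *)
Definition nbetti i A := \rank (indecomp (strands (tower i)) A).

Lemma exact_koszul_ideal A j :
  exact_at (@simplices k n 'rV[k]_1
    [pred S : {set 'I_n} | (S \subset A) && (A :\: S \in U)]) j ->
  exact_at (koszul (strands (tower 0)) A) j.
Proof.
have E S v : koszul (strands (tower 0)) A S v <->
  simplices [pred S : {set 'I_n} | (S \subset A) && (A :\: S \in U)] S v.
  rewrite /koszul /simplices /=; split=> [H v0|H v0].
    have [-> ] := H v0; case: (_ \in U) => //.
    by rewrite scalar_mx0 submx0 (negPf v0).
  by have /andP[-> ->] := H v0; rewrite submx1.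
move=> H z cz bz; have [||w cw bw] := H z; rewrite //.
  by move=> S; have [h1 h2] := cz S; split=> //; apply/E.
by exists w => // S; have [h1 h2] := cw S; split=> //; apply/E.
Qed.

Lemma nbetti_eq0 i A : exact_at (koszul (strands (tower 0)) A) i -> nbetti i A = 0.
Proof.
move=> H.
have shift j : (j <= i)%N -> exact_at (koszul (strands (tower j)) A) (i - j).
  elim: j => [|j IH] ltji; first by rewrite subn0.
  have := IH (ltnW ltji); rewrite (_ : (i - j = (i - j.+1).+1)%N); last by lia.
  by apply: koszul_shift; apply: tower_mono.
by apply: no_indecomp; have := shift i (leqnn i); rewrite subnn.
Qed.

(** The Moebius inversion, on the subsets of A, of the dimensions of the strands
    of stage i. *)
Definition euler i A : int :=
  \sum_(S : {set 'I_n} | S \subset A)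
    (-1) ^+ #|S| * (\rank (strands (tower i) (A :\: S)))%:Z.

Lemma euler_add i A : euler i A + euler i.+1 A = (nbetti i A)%:Z.
Proof.
rewrite -big_split /=.
rewrite (eq_bigr (fun S => \sum_(B : {set 'I_n} | B \subset A :\: S)
    (-1) ^+ #|S| * (nbetti i B)%:Z)); last first.
  move=> S _; rewrite -mulrDr -PoszD rank_cover; last exact: tower_mono.
  by rewrite -mulr_sumr -(big_morph Posz PoszD (erefl _)).
rewrite (exchange_big_dep (fun B : {set 'I_n} => B \subset A)) /=; last first.
  by move=> S B _ sB; apply: subset_trans sB (subsetDl _ _).
rewrite (bigD1 A) //= (big_pred1 set0) => [|S]; last first.
  rewrite subsetD subxx -setI_eq0 /=; apply/andP/eqP => [[sSA /eqP]|->].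
    by rewrite (setIidPr sSA).
  by rewrite sub0set setI0 eqxx.
rewrite cards0 mul1r big1 ?addr0 // => B /andP[sBA neBA].
rewrite -mulr_suml (eq_bigl (fun S => S \subset A :\: B)) => [|S]; last first.
  by rewrite !subsetD sBA /= disjoint_sym.
rewrite alternating_subsets setD_eq0.
case: (boolP (A \subset B)) => sAB; last by rewrite mul0r.
by case/eqP: neBA; apply/eqP; rewrite eqEsubset sBA.
Qed.

Lemma euler0 A : euler 0 A =
  \sum_(S : {set 'I_n} | (S \subset A) && (A :\: S \in U)) (-1) ^+ #|S|.
Proof.
rewrite big_mkcondr; apply: eq_bigr => S _ /=; case: (_ \in U).
  by rewrite mxrank1 mulr1.
by rewrite scalar_mx0 mxrank0 mulr0.
Qed.

(** By [euler_add], the numbers [euler i A] change sign from one step to the next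
    as long as there is no generator of degree A.  They vanish eventually, hence
    right after step [c A], and so the generators of that step account for all
    of [euler 0 A]. *)
Lemma nbetti_euler (c : {set 'I_n} -> nat) :
  (forall A j, j != c A -> nbetti j A = 0) ->
  forall A, (nbetti (c A) A)%:Z = (-1) ^+ c A * euler 0 A.
Proof.
move=> van A.
(* From step m on there are no generators left, in any degree. *)
pose m := (\max_(B : {set 'I_n}) c B).+1.
have ltcm B : (c B < m)%N by rewrite ltnS (leq_bigmax B).
have step j : j != c A -> euler j A = - euler j.+1 A.
  by move=> jc; apply/eqP; rewrite -addr_eq0 euler_add van.
have euler_m : euler m.+1 A = 0.
  apply: big1 => S _; apply/eqP; rewrite mulf_eq0; apply/orP; right.
  rewrite eqz_nat -leqn0; apply: leq_trans (rank_leq_row _) _ => /=.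
  have := card_gens (strands (tower m)) predT.
  rewrite (_ : [set q | _] = setT) ?cardsT ?card_ord => [->|]; last first.
    by apply/setP => q; rewrite !inE.
  by rewrite big1 // => B _; apply: van; rewrite neq_ltn ltcm orbT.
have above d : (c A < m.+1 - d)%N -> euler (m.+1 - d) A = 0.
  elim: d => [|d IH] lt; first by rewrite subn0.
  have e : (m.+1 - d = (m.+1 - d.+1).+1)%N by lia.
  rewrite step; last by rewrite neq_ltn lt orbT.
  by rewrite -e IH ?oppr0 // e ltnW.
have below j : (j <= c A)%N -> euler 0 A = (-1) ^+ j * euler j A.
  elim: j => [|j IH] lt; first by rewrite mul1r.
  rewrite IH ?(ltnW lt) // step; last by rewrite neq_ltn lt.
  by rewrite exprS mulN1r mulrN mulNr.
rewrite -euler_add (below (c A) (leqnn _)) mulrA -exprD addnn -mul2n exprM.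
rewrite sqrrN !expr1n mul1r.
have {1}-> : ((c A).+1 = m.+1 - (m - c A))%N by have := ltcm A; lia.
by rewrite above ?addr0 //; have := ltcm A; lia.
Qed.

Lemma tower_rank i : stage_rank (tower i.+1) = (\sum_A nbetti i A)%N.
Proof.
have := card_gens (strands (tower i)) predT.
by rewrite (_ : [set q | _] = setT) ?cardsT ?card_ord //; apply/setP => q; rewrite !inE.
Qed.

End MinimalResolution.

(** * From strands to matrices of polynomials *)

Section SquarefreeMonomials.
Variable n : nat.
Implicit Types (A B : {set 'I_n}) (u : 'X_{1..n}).

(** Squarefree degrees are embedded into the multidegrees of monomials. *)
Definition sqf A : 'X_{1..n} := [multinom ((i \in A) : nat) | i < n].

Definition vars u : {set 'I_n} := [set i | u i != 0%N].

Lemma sqf_le A u : (sqf A <= u)%MM = (A \subset vars u).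
Proof.
apply/mnm_lepP/subsetP => [H i iA|H i].
  by have := H i; rewrite mnmE iA inE -lt0n.
by rewrite mnmE; case: (boolP (i \in A)) => // /H; rewrite inE -lt0n.
Qed.

Lemma vars_sqf A : vars (sqf A) = A.
Proof. by apply/setP => i; rewrite inE mnmE; case: (i \in A). Qed.

Lemma sqf_le_sqf A B : (sqf A <= sqf B)%MM = (A \subset B).
Proof. by rewrite sqf_le vars_sqf. Qed.

Lemma sqf0 : sqf set0 = 0%MM.
Proof. by apply/mnmP => i; rewrite !mnmE inE. Qed.

End SquarefreeMonomials.

Lemma mcoeff_mulX (k : fieldType) n (p : {mpoly k[n]}) (m u : 'X_{1..n}) :
  (p * 'X_[m])@_u = if (m <= u)%MM then p@_(u - m) else 0.
Proof.
case: (boolP (m <= u)%MM) => mu; first by rewrite -{1}(submK mu) addmC mcoeffMX.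
rewrite mcoeffM big1 // => h /eqP e; rewrite mcoeffX.
case: eqP => [eh|_]; last by rewrite mulr0.
by case/negP: mu; rewrite e eh; apply: lem_addl.
Qed.

Section MonomialMatrices.
Variables (k : fieldType) (n : nat).
Local Notation R := {mpoly k[n]}.
Implicit Types (u : 'X_{1..n}).

(** The part of multidegree u of a row of polynomials, seen as an element of the
    free module whose q-th generator has degree [deg q]; [homogeneous_row] is
    the converse operation. *)
Definition strand m (deg : 'I_m -> {set 'I_n}) u (v : 'rV[R]_m) : 'rV[k]_m :=
  \row_q (if (sqf (deg q) <= u)%MM then (v 0 q)@_(u - sqf (deg q)) else 0).

Definition homogeneous_row m (deg : 'I_m -> {set 'I_n}) u (w : 'rV[k]_m) : 'rV[R]_m :=
  \row_q (w 0 q *: 'X_[u - sqf (deg q)]).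

Lemma strand_free m (deg : 'I_m -> {set 'I_n}) u v :
  (strand deg u v <= free_strand k deg (vars u))%MS.
Proof.
apply/sub_free_strand => q; rewrite mxE sqf_le.
by case: ifP => // _; rewrite eqxx.
Qed.

(** A finite list that contains the multidegrees in which v does not vanish. *)
Definition degrees m (deg : 'I_m -> {set 'I_n}) (v : 'rV[R]_m) : seq 'X_{1..n} :=
  undup (flatten
    [seq [seq (mm + sqf (deg q))%MM | mm <- msupp (v 0 q)] | q <- enum 'I_m]).

Lemma strandK m (deg : 'I_m -> {set 'I_n}) v :
  \sum_(u <- degrees deg v) homogeneous_row deg u (strand deg u v) = v.
Proof.
apply/rowP => q; rewrite summxE; apply/mpolyP => mm.
rewrite raddf_sum /=.
rewrite (eq_bigr (fun u =>
  if u == (mm + sqf (deg q))%MM then (v 0 q)@_mm else 0)); last first.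
  move=> u _; rewrite !mxE mcoeffZ mcoeffX.
  case: (boolP (sqf (deg q) <= u)%MM) => qu.
    rewrite -[X in if X == _ then _ else _](submK qu) (inj_eq (@addIm n _)).
    by case: eqP => [->|_]; rewrite ?mulr1 ?mulr0.
  rewrite mul0r; case: eqP => // e; case/negP: qu; rewrite e addmC; exact: lem_addr.
rewrite -big_mkcond /=.
have [->|nz] := eqVneq (v 0 q)@_mm 0; first by rewrite big1.
rewrite -big_filter filter_pred1_uniq ?undup_uniq ?big_seq1 // mem_undup; apply/flattenP.
exists [seq (mm0 + sqf (deg q))%MM | mm0 <- msupp (v 0 q)].
  by apply/mapP; exists q; rewrite ?mem_enum.
by apply/mapP; exists mm; rewrite // mcoeff_msupp.
Qed.

Lemma strand_eq0 m (deg : 'I_m -> {set 'I_n}) v :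
  (forall u, strand deg u v = 0) -> v = 0.
Proof.
move=> v0; rewrite -(strandK deg v) big1 // => u _; rewrite v0.
by apply/rowP => q; rewrite !mxE scale0r.
Qed.

Section Differential.
Variables (m p : nat) (deg2 : 'I_m -> {set 'I_n}) (deg1 : 'I_p -> {set 'I_n}).
Variable c : 'M[k]_(m, p).

Definition monomial_mx : 'M[R]_(m, p) :=
  \matrix_(i, j) (c i j *: 'X_[sqf (deg2 i) - sqf (deg1 j)]).

Hypothesis cdeg : forall i j, c i j != 0 -> deg1 j \subset deg2 i.

Lemma strand_mul u (v : 'rV[R]_m) :
  strand deg1 u (v *m monomial_mx) = strand deg2 u v *m c.
Proof.
apply/rowP => j; rewrite !mxE.
case: (boolP (sqf (deg1 j) <= u)%MM) => ju; last first.
  rewrite big1 // => i _; rewrite !mxE.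
  have [->|/cdeg cij] := eqVneq (c i j) 0; first by rewrite mulr0.
  case: ifP => iu; last by rewrite mul0r.
  by case/negP: ju; apply: lepm_trans iu; rewrite sqf_le_sqf.
rewrite raddf_sum /=; apply: eq_bigr => i _; rewrite !mxE -scalerAr mcoeffZ.
have [->|/cdeg cij] := eqVneq (c i j) 0; first by rewrite mulr0 mul0r.
rewrite mulrC; congr (_ * _); rewrite mcoeff_mulX.
have lij : (sqf (deg1 j) <= sqf (deg2 i))%MM by rewrite sqf_le_sqf.
have -> : (sqf (deg2 i) - sqf (deg1 j) <= u - sqf (deg1 j))%MM = (sqf (deg2 i) <= u)%MM.
  apply/mnm_lepP/mnm_lepP => H l; have := H l; have /mnm_lepP/(_ l) := ju;
  have /mnm_lepP/(_ l) := lij; rewrite !mnmBE; lia.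
case: ifP => // iu; congr (_@__); apply/mnmP => l; rewrite !mnmBE.
by have /mnm_lepP/(_ l) := ju; have /mnm_lepP/(_ l) := lij; lia.
Qed.

Lemma homogeneous_row_mul u (w : 'rV[k]_m) : (w <= free_strand k deg2 (vars u))%MS ->
  homogeneous_row deg2 u w *m monomial_mx = homogeneous_row deg1 u (w *m c).
Proof.
move=> /sub_free_strand wu; apply/rowP => j; rewrite !mxE scaler_suml.
apply: eq_bigr => i _; rewrite !mxE.
have [->|/cdeg cij] := eqVneq (c i j) 0; first by rewrite mulr0 !scale0r mulr0.
have [->|/wu iu] := eqVneq (w 0 i) 0; first by rewrite mul0r !scale0r mul0r.
rewrite -scalerAl -scalerAr scalerA -mpolyXD; congr (_ *: 'X_[_]).
move: cij iu; rewrite -sqf_le_sqf -sqf_le => /mnm_lepP lij /mnm_lepP liu.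
by apply/mnmP => l; rewrite mnmDE !mnmBE; have := lij l; have := liu l; lia.
Qed.

(** Preimages can be taken strand by strand and added up, since v has finitely many
    nonzero strands. *)
Lemma monomial_lift (v : 'rV[R]_p) :
  (forall u, (strand deg1 u v <= free_strand k deg2 (vars u) *m c)%MS) ->
  exists w, w *m monomial_mx = v.
Proof.
move=> H.
pose w u := strand deg1 u v *m pinvmx (free_strand k deg2 (vars u) *m c)
            *m free_strand k deg2 (vars u).
exists (\sum_(u <- degrees deg1 v) homogeneous_row deg2 u (w u)).
rewrite mulmx_suml -[RHS](strandK deg1); apply: eq_bigr => u _.
rewrite homogeneous_row_mul; last exact: submxMl.
by rewrite /w -mulmxA mulmxKpV.
Qed.

End Differential.
End MonomialMatrices.

Section Resolution.
Variables (k : fieldType) (n : nat) (U : {set {set 'I_n}}).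
Implicit Types (A B C S : {set 'I_n}).
Hypothesis Uup : forall A B, A \subset B -> A \in U -> B \in U.
Local Notation R := {mpoly k[n]}.
Local Notation tower := (tower k U).

(** The degrees of the ambient generators of stage i; stage 0 lives in the ring,
    generated in degree 0. *)
Definition tower_deg i : 'I_(stage_rank (tower i)) -> {set 'I_n} :=
  if i is i'.+1 then @gdeg _ _ _ (strands (tower i')) else fun=> set0.

Definition tower_mx i : 'M[k]_(stage_rank (tower i.+1), stage_rank (tower i)) :=
  cover_mx (strands (tower i)).

Lemma tower_mx_sub i A (v : 'rV_(stage_rank (tower i.+1))) :
  (v <= free_strand k (@tower_deg i.+1) A)%MS ->
  (v *m tower_mx i <= strands (tower i) A)%MS.
Proof.
move=> vA; apply: submx_trans (submxMr _ vA) _.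
by apply: (@cover_sub _ _ _ (strands (tower i))); apply: tower_mono.
Qed.

Lemma tower_mx_onto i A :
  (strands (tower i) A <= free_strand k (@tower_deg i.+1) A *m tower_mx i)%MS.
Proof. exact: cover_onto. Qed.

Lemma tower_syz i A (v : 'rV_(stage_rank (tower i.+1))) :
  (v <= strands (tower i.+1) A)%MS =
  (v *m tower_mx i == 0) && (v <= free_strand k (@tower_deg i.+1) A)%MS.
Proof. by rewrite /= sub_syz //; apply: tower_mono. Qed.

Lemma row_tower_mx i j :
  (row j (tower_mx i) <= strands (tower i) (@tower_deg i.+1 j))%MS.
Proof. exact: submx_trans (cover_row j) (diffmxSl _ _). Qed.

Lemma tower_mx_deg i q p :
  tower_mx i q p != 0 -> @tower_deg i p \subset @tower_deg i.+1 q.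
Proof.
case: i q p => [|i] q p; first by move=> _; apply: sub0set.
have := row_tower_mx q; rewrite tower_syz => /andP[_ /sub_free_strand/(_ p)].
by rewrite mxE.
Qed.

(** A minimal relation of degree A has no component on the generators of degree A,
    so no entry of a differential beyond the augmentation is a nonzero
    constant. *)
Lemma tower_mx_minimal i q p :
  tower_mx i.+1 q p != 0 -> @tower_deg i.+1 p != @tower_deg i.+2 q.
Proof.
move=> nz; apply/negP => /eqP epq; case/eqP: nz.
have := row_tower_mx q; move/(syz_minimal (@tower_mono _ _ _ Uup i))/(_ p epq).
by rewrite mxE.
Qed.

Definition tower_diff i : 'M[R]_(stage_rank (tower i.+1), stage_rank (tower i)) :=
  monomial_mx (@tower_deg i.+1) (@tower_deg i) (tower_mx i).

Definition resolution : free_complex R :=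
  @FreeComplex R (fun i => stage_rank (tower i.+1))
    (fun i => tower_diff i.+1) (tower_diff 0).

Lemma strand_tower_diff i u (v : 'rV_(stage_rank (tower i.+1))) :
  strand (@tower_deg i) u (v *m tower_diff i) = strand (@tower_deg i.+1) u v *m tower_mx i.
Proof. by apply: strand_mul => q p; apply: tower_mx_deg. Qed.

(** The image of the i-th differential is the module of stage i, in every
    multidegree and not only in squarefree ones: a multidegree u is divisible by
    the same squarefree degrees as its support. *)
Lemma tower_diff_image i (v : 'rV[R]_(stage_rank (tower i))) :
  (exists w, w *m tower_diff i = v) <->
  forall u, (strand (@tower_deg i) u v <= strands (tower i) (vars u))%MS.
Proof.
split=> [[w <-] u|H].
  by rewrite strand_tower_diff; apply: tower_mx_sub; apply: strand_free.
apply: monomial_lift => [q p|u]; first exact: tower_mx_deg.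
exact: submx_trans (H u) (tower_mx_onto _ _).
Qed.

Lemma tower_diff_exact i (v : 'rV[R]_(stage_rank (tower i.+1))) :
  v *m tower_diff i = 0 <-> exists w, w *m tower_diff i.+1 = v.
Proof.
rewrite tower_diff_image; split=> [v0 u|H].
  rewrite tower_syz -strand_tower_diff v0 strand_free andbT.
  by apply/eqP/rowP => q; rewrite !mxE mcoeff0 if_same.
apply: (@strand_eq0 _ _ _ (@tower_deg i)) => u; rewrite strand_tower_diff.
by have := H u; rewrite tower_syz => /andP[/eqP].
Qed.

Lemma tower_diff0_image (f : R) :
  (exists v : 'rV_(stage_rank (tower 1)), (v *m tower_diff 0) ord0 ord0 = f) <->
  forall u, u \in msupp f -> vars u \in U.
Proof.
have strand0 u : strand (@tower_deg 0) u (f%:M) = (f@_u)%:M.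
  by apply/rowP => q; rewrite !mxE !ord1 /= sqf_le sub0set sqf0 subm0.
have -> : (exists v : 'rV_(stage_rank (tower 1)),
      (v *m tower_diff 0) ord0 ord0 = f)
    <-> (exists v : 'rV_(stage_rank (tower 1)), v *m tower_diff 0 = f%:M).
  split=> -[v e]; exists v; last by rewrite e mxE eqxx.
  by apply/rowP => q; rewrite ord1 e mxE eqxx.
rewrite (tower_diff_image (i := 0)); split=> H u.
  rewrite mcoeff_msupp => fu; have := H u; rewrite strand0 /=.
  case: (_ \in U) => //; rewrite scalar_mx0 submx0 => /eqP/rowP/(_ 0).
  by rewrite !mxE eqxx => /eqP; rewrite (negPf fu).
rewrite strand0 /=; case: (boolP (u \in msupp f)) => [/H->|]; first exact: submx1.
by rewrite mcoeff_msupp negbK => /eqP->; rewrite raddf0 sub0mx.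
Qed.

Lemma resolution_minimal (I : R -> Prop) :
  (forall f, I f <-> forall u, u \in msupp f -> vars u \in U) ->
  minimal_free_resolution I resolution.
Proof.
move=> HI; split; first split=> [f|v|i v].
- by rewrite HI -tower_diff0_image.
- exact: (@tower_diff_exact 0 v).
- exact: (@tower_diff_exact i.+1 v).
move=> i p q; rewrite mxE mcoeffZ mcoeffX.
have [->|nz] := eqVneq (tower_mx i.+1 p q) 0; first by rewrite mul0r.
case: eqP => [e|_]; last by rewrite mulr0.
case/eqP: (tower_mx_minimal nz); apply/eqP; rewrite eqEsubset tower_mx_deg //=.
rewrite -sqf_le_sqf; apply/mnm_lepP => l.
by have := congr1 (fun m : 'X_{1..n} => m l) e; rewrite mnmBE mnm0E => /eqP.
Qed.

End Resolution.

(** * Uniqueness of the ranks of a minimal resolution *)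

Section Lift.
Variable R : comNzRingType.

(** A total choice of solutions lets [comparison] and [homotopy] be defined by
    plain recursion; their equations are proved afterwards. *)
Definition lift_mx m p q (D : 'M[R]_(m, p)) (B : 'M[R]_(q, p)) : 'M[R]_(q, m) :=
  epsilon (inhabits 0) (fun X => X *m D = B).

Lemma lift_mxK m p q (D : 'M[R]_(m, p)) (B : 'M[R]_(q, p)) :
  (forall i, exists w, w *m D = row i B) -> lift_mx D B *m D = B.
Proof.
move=> H; apply: (epsilon_spec (inhabits (0 : 'M[R]_(q, m))) (fun X => X *m D = B)).
have [w Hw] := fin_all_exists H.
exists (\matrix_i w i); apply/row_matrixP => i.
by rewrite row_mul rowK Hw.
Qed.

Section Resolutions.
Variables (I : R -> Prop) (F G : free_complex R).
Hypotheses (resF : free_resolution I F) (resG : free_resolution I G).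

Lemma fdiff_aug : fdiff F 0 *m faug F = 0.
Proof.
case: resF => _ H _; apply/row_matrixP => i; rewrite row_mul row0.
by apply/H; exists (delta_mx 0 i); rewrite rowE.
Qed.

Lemma fdiff_fdiff i : fdiff F i.+1 *m fdiff F i = 0.
Proof.
case: resF => _ _ H; apply/row_matrixP => j; rewrite row_mul row0.
by apply/H; exists (delta_mx 0 j); rewrite rowE.
Qed.

Fixpoint comparison i : 'M[R]_(frank F i, frank G i) :=
  if i is j.+1 then lift_mx (fdiff G j) (fdiff F j *m comparison j)
  else lift_mx (faug G) (faug F).

Lemma comparison_aug : comparison 0 *m faug G = faug F.
Proof.
apply: lift_mxK => i; case: resF => HF _ _; case: resG => HG _ _.
have /HG[v e] : I (faug F i ord0).
  by apply/HF; exists (delta_mx 0 i); rewrite -rowE mxE.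
by exists v; apply/rowP => j; rewrite ord1 e mxE.
Qed.

Lemma comparison_fdiff i :
  comparison i.+1 *m fdiff G i = fdiff F i *m comparison i.
Proof.
elim: i => [|i IH]; apply: lift_mxK => j; case: resG => _ H0 HS.
  by apply/H0; rewrite -row_mul -mulmxA comparison_aug fdiff_aug row0.
by apply/HS; rewrite -row_mul -mulmxA IH mulmxA fdiff_fdiff mul0mx row0.
Qed.

End Resolutions.

Section Homotopy.
Variables (I : R -> Prop) (F : free_complex R).
Hypothesis resF : free_resolution I F.
Variable theta : forall i, 'M[R]_(frank F i).
Hypothesis theta_aug : theta 0 *m faug F = faug F.
Hypothesis theta_fdiff : forall i, theta i.+1 *m fdiff F i = fdiff F i *m theta i.

Fixpoint homotopy i : 'M[R]_(frank F i, frank F i.+1) :=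
  if i is j.+1 then lift_mx (fdiff F j.+1) (theta j.+1 - 1%:M - fdiff F j *m homotopy j)
  else lift_mx (fdiff F 0) (theta 0 - 1%:M).

Lemma homotopy0 : homotopy 0 *m fdiff F 0 = theta 0 - 1%:M.
Proof.
apply: lift_mxK => j; case: resF => _ H0 _; apply/H0.
by rewrite -row_mul mulmxBl mul1mx theta_aug subrr row0.
Qed.

Lemma homotopyS i :
  homotopy i.+1 *m fdiff F i.+1 = theta i.+1 - 1%:M - fdiff F i *m homotopy i.
Proof.
elim: i => [|i IH]; apply: lift_mxK => j; case: resF => _ _ HS; apply/HS.
  rewrite -row_mul !mulmxBl mul1mx theta_fdiff -mulmxA homotopy0 mulmxBr mulmx1.
  by rewrite subrr row0.
rewrite -row_mul !mulmxBl mul1mx theta_fdiff -mulmxA IH !mulmxBr mulmx1.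
by rewrite mulmxA (fdiff_fdiff resF) mul0mx subr0 subrr row0.
Qed.

(** An endomorphism of a resolution that lifts the identity is homotopic to the
    identity, and the homotopy terms vanish under any morphism that kills the
    differentials. *)
Lemma minimal_endomorphism (K : comNzRingType) (eps : {rmorphism R -> K}) :
  (forall i p q, eps (fdiff F i p q) = 0) ->
  forall i, map_mx eps (theta i) = 1%:M.
Proof.
move=> eps0; have e0 i : map_mx eps (fdiff F i) = 0.
  by apply/matrixP => p q; rewrite !mxE.
case=> [|i]; apply/eqP; rewrite -subr_eq0 -(map_mx1 eps) -map_mxB.
  by rewrite -homotopy0 map_mxM e0 mulmx0.
by rewrite -(subrK (fdiff F i *m homotopy i) (_ - _)) -homotopyS map_mxD !map_mxM !e0
  mulmx0 mul0mx addr0.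
Qed.

End Homotopy.

(** Going from F to G and back becomes the identity under the morphism, so the
    identity matrix of size [frank F i] factors through size [frank G i]. *)
Lemma minimal_rank_le (K : fieldType) (eps : {rmorphism R -> K}) (I : R -> Prop)
    (F G : free_complex R) :
  free_resolution I F -> free_resolution I G ->
  (forall i p q, eps (fdiff F i p q) = 0) ->
  forall i, (frank F i <= frank G i)%N.
Proof.
move=> resF resG eps0 i.
apply: (@mulmx1_min _ _ _
  (map_mx eps (comparison F G i)) (map_mx eps (comparison G F i))).
rewrite -map_mxM.
apply: (@minimal_endomorphism I F resF
  (fun i => comparison F G i *m comparison G F i)) => //.
  by rewrite -mulmxA (comparison_aug resG resF) (comparison_aug resF resG).
move=> j; rewrite -mulmxA (comparison_fdiff resG resF) mulmxA.
by rewrite (comparison_fdiff resF resG) mulmxA.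
Qed.

End Lift.

(** The morphism that kills the differentials is the constant term. *)
Lemma betti_minimal (k : fieldType) n (I : {mpoly k[n]} -> Prop)
    (F : free_complex {mpoly k[n]}) :
  minimal_free_resolution I F -> forall i, betti I i = frank F i.
Proof.
move=> minF i; rewrite /betti; set G := epsilon _ _.
have minG : minimal_free_resolution I G by apply: epsilon_spec; exists F.
case: minF minG => resF epsF [resG epsG].
pose eps : {rmorphism {mpoly k[n]} -> k} := mcoeff 0%MM.
apply/eqP; rewrite eqn_leq; apply/andP; split.
  exact: (minimal_rank_le (eps := eps) resG resF).
exact: (minimal_rank_le (eps := eps) resF resG).
Qed.

(** * Matroid Steiner ideals *)

Section FaceIdeal.
Variables (k : fieldType) (T : finType) (V : {set T}) (D : {set {set T}}).
Implicit Types F : {set T}.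
Hypothesis Ddown : forall F F', F \subset F' -> F' \in D -> F \in D.

Lemma sqfree_monomialE F :
  sqfree_monomial k V F = 'X_[sqf [set j | enum_val j \in F]].
Proof.
rewrite /sqfree_monomial mpolyXE_id big_mkcond; apply: eq_bigr => j _.
by rewrite mnmE inE; case: (_ \in F).
Qed.

(** A monomial ideal contains a polynomial exactly when it contains each of its
    monomials; conversely each term is a multiple of the squarefree monomial
    with the same support. *)
Lemma face_idealP (f : {mpoly k[#|V|]}) :
  face_ideal k V D f <->
  forall u, u \in msupp f -> enum_val @: vars u \notin D.
Proof.
pose vert (u : 'X_{1..#|V|}) : {set T} := enum_val @: vars u.
have vertV u : vert u \subset V.
  by apply/subsetP => x /imsetP[j _ ->]; apply: enum_valP.
split=> [[c ->] u|H].
  rewrite mcoeff_msupp raddf_sum /=; apply: contra => uD; apply/eqP.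
  apply: big1 => F /andP[]; rewrite powersetE => FV FD.
  rewrite sqfree_monomialE mcoeff_mulX sqf_le; case: ifP => // Fu.
  case/negP: FD; apply: Ddown uD; apply/subsetP => x xF.
  have xV := subsetP FV _ xF; apply/imsetP; exists (enum_rank_in xV x).
    by apply: (subsetP Fu); rewrite inE enum_rankK_in.
  by rewrite enum_rankK_in.
exists (fun F => \sum_(u <- msupp f | vert u == F)
   f@_u *: 'X_[u - sqf [set j | enum_val j \in F]]).
rewrite {1}[f]mpolyE big_seq.
rewrite (partition_big vert (fun F => (F \in powerset V) && (F \notin D))) /=; last first.
  by move=> u uf; rewrite powersetE vertV H.
apply: eq_bigr => F _; rewrite mulr_suml [RHS]big_seq_cond.
apply: eq_bigr => u /andP[_ /eqP uF].
rewrite sqfree_monomialE -scalerAl -mpolyXD submK // sqf_le.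
apply/subsetP => j; rewrite inE -uF => /imsetP[j' j'u /enum_val_inj->//].
Qed.

End FaceIdeal.

Section SteinerIdeal.
Variables (k : fieldType) (E : finType) (M : matroid E) (e : E).
Local Notation V := [set~ e].
Local Notation N := (dual M).
Local Notation n := #|V|.
Local Notation g := (@enum_val E (mem V)).
Implicit Types (A B S : {set 'I_n}) (X Y F : {set E}).

Lemma image_avoids_e A : e \notin g @: A.
Proof. by apply/imsetP => -[j _ eE]; have := enum_valP j; rewrite -eE !inE eqxx. Qed.

Lemma image_preimage X : e \notin X -> g @: (g @^-1: X) = X.
Proof.
move=> eX; apply/setP => x; apply/imsetP/idP => [[j]|xX]; first by rewrite inE => jX ->.
have xV : x \in V by rewrite !inE; apply: contraNneq eX => <-.
by exists (enum_rank_in xV x); rewrite ?inE enum_rankK_in.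
Qed.

Lemma preimage_image A : g @^-1: (g @: A) = A.
Proof.
by apply/setP => j; rewrite inE (mem_imset _ _ enum_val_inj).
Qed.

Lemma imageC A : g @: (~: A) = ~: (e |: g @: A).
Proof.
apply/setP => x; rewrite !inE negb_or; apply/imsetP/andP => [[j jA ->]|[xe xA]].
  split; first by have := enum_valP j; rewrite !inE.
  by rewrite (mem_imset _ _ enum_val_inj) -in_setC.
have xV : x \in V by rewrite !inE.
exists (enum_rank_in xV x); last by rewrite enum_rankK_in.
rewrite inE; apply: contra xA => xA; apply/imsetP.
by exists (enum_rank_in xV x); rewrite ?enum_rankK_in.
Qed.

(** The sets are indexed by the variables, and the complement of A among the
    variables stands for the complement of F in E - e. *)
Definition steiner_supports : {set {set 'I_n}} :=
  [set A : {set 'I_n} | avoids N e g (~: A)].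
Local Notation U := steiner_supports.

Lemma steiner_supports_up A B : A \subset B -> A \in U -> B \in U.
Proof. by rewrite !inE -setCS; apply: avoids_anti. Qed.

Lemma steiner_complexN A : (g @: A \notin steiner_complex M e) = (A \in U).
Proof.
have eA := image_avoids_e A.
rewrite !inE /avoids imageC -dual_closure //.
have -> : g @: A \subset V by rewrite subsetC sub1set inE.
rewrite /= negb_forall_in; apply/exists_inP/idP => [[P PP]|].
  by rewrite negbK => sP; apply/port_spanned => //; exists P.
by move/port_spanned => /(_ eA)[P PP sP]; exists P; rewrite ?negbK.
Qed.

Lemma steiner_idealP (f : {mpoly k[n]}) :
  steiner_ideal k M e f <-> forall u, u \in msupp f -> vars u \in U.
Proof.
rewrite /steiner_ideal face_idealP => [|F F' sF]; last first.
  rewrite !inE => /andP[F'V /forall_inP F'P]; rewrite (subset_trans sF) //=.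
  by apply/forall_inP => P /F'P; apply: contra => /subset_trans; apply.
by split=> H u /H; rewrite steiner_complexN.
Qed.

Lemma betti_steiner i : betti (steiner_ideal k M e) i = (\sum_A nbetti k U i A)%N.
Proof.
rewrite -tower_rank.
exact: (betti_minimal (resolution_minimal steiner_supports_up steiner_idealP) i).
Qed.

Lemma rk_image_full A : rk N (e |: g @: (~: A :|: A)) = rk N setT.
Proof.
rewrite [~: A :|: A]setUC setUCr; congr (rk N _); apply/setP => x; rewrite !inE.
case: eqP => //= /eqP xe; have xV : x \in V by rewrite !inE.
by apply/imsetP; exists (enum_rank_in xV x); rewrite ?in_setT ?enum_rankK_in.
Qed.

(** The number [i] must be the only degree in which [exact_avoiding] allows homology
    for X the complement of A and W = A, and X must be a flat; if X spans e the
    complex has no simplex at all, and if it spans an element of A the complex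
    is a cone. *)
Lemma nbetti_steiner0 i A :
  ~~ ((g @: (~: A) \in flats N) && ((rk N (g @: (~: A)) + i).+1 == rk N setT)) ->
  nbetti k U i A = 0.
Proof.
move=> H; apply: nbetti_eq0; first exact: steiner_supports_up.
apply: exact_koszul_ideal.
apply: (@eq_exact_simplices _ _ _ (avoiding_complex N e g (~: A) A)) => [S|].
  rewrite /avoiding_complex /= inE; congr (_ && avoids _ _ _ _).
  by rewrite setDE setCI setCK.
have [flatX|nflatX] := boolP (g @: (~: A) \in flats N); last first.
  have [x xcl xX] : exists2 x, x \in closure N (g @: (~: A)) & x \notin g @: (~: A).
    apply/subsetPn; apply: contra nflatX => sX; apply/flatP/eqP.
    by rewrite eqEsubset sX sub_closure.
  have [xe|xe] := eqVneq x e.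
    rewrite {x xX}xe in xcl.
    move=> z /chain_simplices cz bz; exists (fun=> 0).
      by apply/chain_simplices => S; rewrite eqxx.
    move=> S; rewrite boundary0; have [->//|/cz[/andP[_]]] := eqVneq (z S) 0.
    by move/(avoids_anti (subsetUl (~: A) S)); rewrite /avoids xcl.
  have xV : x \in V by rewrite !inE.
  apply: (@exact_avoiding_loop _ _ _ _ _ _ _ _ _ (enum_rank_in xV x)).
    rewrite -[A]setCK inE; apply: contra xX => xA.
    by apply/imsetP; exists (enum_rank_in xV x); rewrite ?enum_rankK_in.
  by rewrite enum_rankK_in.
apply: exact_avoiding; rewrite rk_image_full addnS eq_sym.
by move: H; rewrite flatX.
Qed.

Lemma euler_steiner A : g @: (~: A) \in flats N ->
  euler k U 0 A = \sum_(Y in flats N | e \notin Y) mobius (flats N) (g @: (~: A)) Y.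
Proof.
move=> flatX; rewrite sum_mobius_avoiding // euler0.
rewrite [RHS](reindex_onto (fun S => g @: S) (fun Y => g @^-1: Y)) /=; last first.
  move=> Y /andP[_ eY]; apply: image_preimage; apply: contra eY => eY.
  by apply: (subsetP (sub_closure _ _)); rewrite inE eY orbT.
apply: eq_big => [S|S _]; last by rewrite card_imset //; apply: enum_val_inj.
rewrite preimage_image eqxx andbT inE /avoids setDE setCI setCK imsetU imageC.
congr (_ && _).
rewrite setCK; apply/idP/idP => [sSA|sSA].
  exact: subset_trans (imsetS _ sSA) (subsetUr _ _).
rewrite -(preimage_image S) -(preimage_image A); apply/subsetP => j.
rewrite !inE => /(subsetP sSA); rewrite !inE => /orP[/eqP je|//].
by have := enum_valP j; rewrite je !inE eqxx.
Qed.

Lemma nbetti_steiner i A :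
  (nbetti k U i A)%:Z =
  if (g @: (~: A) \in flats N) && ((rk N (g @: (~: A)) + i).+1 == rk N setT)
  then (-1) ^+ i * \sum_(Y in flats N | e \notin Y) mobius (flats N) (g @: (~: A)) Y
  else 0.
Proof.
case: ifP => [/andP[flatX /eqP rkX]|/negbT H]; last by rewrite nbetti_steiner0.
rewrite -euler_steiner //.
pose c B := ((rk N setT).-1 - rk N (g @: (~: B)))%N.
have -> : i = c A by rewrite /c -rkX /= addKn.
apply: nbetti_euler => [|B j jc]; first exact: steiner_supports_up.
apply: nbetti_steiner0; apply: contra jc => /andP[_ /eqP rkB].
by rewrite /c -rkB /= addKn.
Qed.

Lemma sum_mobius_containing X : e \in X ->
  \sum_(Y in flats N | e \notin Y) mobius (flats N) X Y = 0.
Proof.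
move=> eX; apply: big1 => Y /andP[_ eY]; rewrite mobiusE.
case: eqP => [XY|_]; first by rewrite -XY eX in eY.
by case: ifP => // /subsetP/(_ e eX); rewrite (negPf eY).
Qed.

End SteinerIdeal.

Theorem corollary7p3 (k : fieldType) (E : finType) (M : matroid E) (e : E)
    (n r : nat) (hE : #|E| = n.+1) (hr : rk M [set: E] = r) (i : nat) :
  (betti (steiner_ideal k M e) i)%:Z =
    `| \sum_(X in flats (dual M) | (rk (dual M) X)%:Z == n%:Z - r%:Z - i%:Z)
         \sum_(Y in flats (dual M) | e \notin Y)
           mobius (flats (dual M)) X Y |.
Proof.
have rkN : (rk (dual M) setT + r = n.+1)%N.
  have := dual_rk M setT; rewrite setCT cardsT hr hE => ->.
  by have := rk_card M set0; rewrite cards0 leqn0 => /eqP->; rewrite addn0.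
set mu := fun X => \sum_(Y in flats (dual M) | e \notin Y) mobius (flats (dual M)) X Y.
have eqsum : \sum_(X in flats (dual M) | (rk (dual M) X)%:Z == n%:Z - r%:Z - i%:Z) mu X
  = \sum_(A : {set 'I_#|[set~ e]|} |
      (@enum_val E (mem [set~ e]) @: (~: A) \in flats (dual M)) &&
      ((rk (dual M) (@enum_val E (mem [set~ e]) @: (~: A)) + i).+1 == rk (dual M) setT))
      mu (@enum_val E (mem [set~ e]) @: (~: A)).
  rewrite (bigID (fun X : {set E} => e \in X)) /= big1 ?add0r; last first.
    by move=> X /andP[_ eX]; apply: sum_mobius_containing.
  rewrite (reindex_onto (fun A => @enum_val E (mem [set~ e]) @: (~: A))
     (fun X => ~: (@enum_val E (mem [set~ e]) @^-1: X))) /=; last first.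
    by move=> X /andP[_ eX]; rewrite setCK image_preimage.
  apply: eq_bigl => A; rewrite image_avoids_e andbT preimage_image setCK eqxx andbT.
  congr (_ && _); move: rkN; move: (rk _ setT) => d; move: (rk _ _) => x rkN.
  by apply/eqP/eqP => H; lia.
rewrite eqsum; set s := \sum_(A | _) _.
have betti_s : (betti (steiner_ideal k M e) i)%:Z = (-1) ^+ i * s.
  rewrite betti_steiner (big_morph Posz PoszD (erefl _)).
  by rewrite (eq_bigr _ (fun A _ => nbetti_steiner k M i A)) -big_mkcond /= -mulr_sumr.
have -> : `|s| = `|(-1) ^+ i * s| by rewrite normrM normrX normrN1 expr1n mul1r.
by rewrite -betti_s ger0_norm.
Qed.
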